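(* Let $\mathfrak{g}$ be a complex semisimple Lie algebra with fixed Borel subalgebra $\mathfrak{b}$, Cartan subalgebra $\mathfrak{h}\subset\mathfrak{b}$ and $\mathfrak{n}=[\mathfrak{b},\mathfrak{b}]$. Let $\eta:\mathfrak{n}\to\mathbb{C}$ be a Lie algebra morphism, let $\mathfrak{l}_\eta=\overline{\mathfrak{n}}_\eta\oplus\mathfrak{h}\oplus\mathfrak{n}_\eta\subset\mathfrak{g}$ be the corresponding reductive Lie subalgebra determined by the simple root spaces on which $\eta$ does not vanish, and let $\mathfrak{p}_\eta$ be the standard parabolic subalgebra with Levi factor $\mathfrak{l}_\eta$. Let $V$ be an irreducible finitely generated $U(\mathfrak{l}_\eta)$-module with the property that for each $v\in V$ there exists $k\in\mathbb{Z}_{>0}$ such that $(x-\eta(x))^k v=0$ for all $x\in\mathfrak{n}_\eta$. Then the vector space $\Psi_V$ of contravariant forms on the $\mathfrak{l}_\eta$-module $V$ is isomorphic to the vector space $\Psi_{\mathrm{Ind}_{\mathfrak{l}_\eta}^{\mathfrak{g}}V}$ of contravariant forms on the parabolically induced $\mathfrak{g}$-module $\mathrm{Ind}_{\mathfrak{l}_\eta}^{\mathfrak{g}}V:=U(\mathfrak{g})\otimes_{U(\mathfrak{p}_\eta)}V$.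
   Context: Let $\Pi\subset\Sigma^+\subset\Sigma\subset\mathfrak{h}^*$ be the simple roots, positive roots and roots determined by $\mathfrak{b}$, with root spaces $\mathfrak{g}_\alpha$. Fix a Chevalley basis $\{y_\alpha,x_\alpha\}_{\alpha\in\Sigma^+}\cup\{h_\alpha\}_{\alpha\in\Pi}$ with $x_\alpha\in\mathfrak{g}_\alpha$, $y_\alpha\in\mathfrak{g}_{-\alpha}$, $h_\alpha\in\mathfrak{h}$, $[x_\alpha,y_\alpha]=h_\alpha$. $U(\cdot)$ denotes the universal enveloping algebra. For $\eta:\mathfrak{n}\to\mathbb{C}$, let $\Pi_\eta=\{\alpha\in\Pi:\eta|_{\mathfrak{g}_\alpha}\neq0\}$, let $\Sigma_\eta\subset\Sigma$ be the root system generated by $\Pi_\eta$, $\Sigma_\eta^+=\Sigma_\eta\cap\Sigma^+$, and $$\mathfrak{l}_\eta=\mathfrak{h}\oplus\bigoplus_{\alpha\in\Sigma_\eta}\mathfrak{g}_\alpha,\quad \mathfrak{n}_\eta=\bigoplus_{\alpha\in\Sigma_\eta^+}\mathfrak{g}_\alpha,\quad \overline{\mathfrak{n}}_\eta=\bigoplus_{\alpha\in\Sigma_\eta^+}\mathfrak{g}_{-\alpha},\quad \mathfrak{n}^\eta=\bigoplus_{\alpha\in\Sigma^+\setminus\Sigma_\eta^+}\mathfrak{g}_\alpha,\quad \mathfrak{p}_\eta=\mathfrak{l}_\eta\oplus\mathfrak{n}^\eta.$$ A $U(\mathfrak{l}_\eta)$-module $V$ is regarded as a $U(\mathfrak{p}_\eta)$-module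 by letting $\mathfrak{n}^\eta$ act by zero. Let $\tau:U(\mathfrak{g})\to U(\mathfrak{g})$ be the antiautomorphism with $\tau(x_\alpha)=y_\alpha$, $\tau(y_\alpha)=x_\alpha$, $\tau(h_\alpha)=h_\alpha$; it preserves $U(\mathfrak{l}_\eta)$. For $\mathfrak{a}=\mathfrak{g}$ or $\mathfrak{a}=\mathfrak{l}_\eta$, a contravariant form on a $U(\mathfrak{a})$-module $X$ is a symmetric bilinear form $\langle\cdot,\cdot\rangle:X\times X\to\mathbb{C}$ with $\langle uv,w\rangle=\langle v,\tau(u)w\rangle$ for all $u\in U(\mathfrak{a})$, $v,w\in X$; $\Psi_X$ is the complex vector space of all of them. *)

(* Defs.v *)
From HB Require Import structures.
From mathcomp Require Import all_boot all_order all_algebra.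
From mathcomp Require Import generic_quotient boolp functions.

Set Implicit Arguments.
Unset Strict Implicit.
Unset Printing Implicit Defensive.

Import Order.TTheory GRing.Theory Num.Theory.
Local Open Scope ring_scope.
Local Open Scope quotient_scope.

HB.mixin Record Vector_isLieAlgebra (F : fieldType) L of Vector F L := {
  lie : L -> L -> L;
  lie_linear : forall x, linear (lie x);
  lie_linearl : forall y, linear (lie^~ y);
  liexx : forall x, lie x x = 0;
  lie_jacobi : forall x y z,
    lie x (lie y z) + lie y (lie z x) + lie z (lie x y) = 0
}.

#[short(type="lieAlgType")]
HB.structure Definition LieAlgebra (F : fieldType) :=
  { L of Vector F L & Vector_isLieAlgebra F L }.

Section LieTheory.
Variables (F : fieldType) (L : lieAlgType F).
Implicit Types (x y z : L) (U V W I : {vspace L}).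

HB.instance Definition _ x :=
  GRing.isLinear.Build F L L _ (lie x) (lie_linear x).

Lemma lieDr x y z : lie x (y + z) = lie x y + lie x z.
Proof. exact: raddfD. Qed.
Lemma lieZr x a y : lie x (a *: y) = a *: lie x y.
Proof. exact: linearZ. Qed.
Lemma lieDl x y z : lie (y + z) x = lie y x + lie z x.
Proof. by have /= := lie_linearl x 1 y z; rewrite !scale1r. Qed.
Lemma lie0l x : lie 0 x = 0.
Proof. by apply: (addrI (lie 0 x)); rewrite -lieDl !addr0. Qed.
Lemma lieZl x a y : lie (a *: y) x = a *: lie y x.
Proof. by have /= := lie_linearl x a y 0; rewrite !addr0 lie0l addr0. Qed.

Lemma lieC x y : lie x y = - lie y x.
Proof.
have := liexx (x + y); rewrite lieDr !lieDl !liexx add0r addr0 addrC.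
by move/eqP; rewrite addr_eq0 => /eqP.
Qed.

Lemma lie_leibniz x y z : lie x (lie y z) = lie (lie x y) z + lie y (lie x z).
Proof.
have := lie_jacobi x y z.
rewrite (lieC z (lie x y)) (lieC z x) raddfN /= -addrA => /eqP.
by rewrite addr_eq0 opprD !opprK addrC => /eqP.
Qed.

Lemma lie_suml (I : Type) (r : seq I) (P : pred I) (G : I -> L) x :
  lie (\sum_(i <- r | P i) G i) x = \sum_(i <- r | P i) lie (G i) x.
Proof.
by elim/big_rec2: _ => [|i u v _ <-]; rewrite ?lie0l ?lieDl.
Qed.

Definition ad x : 'End(L) := linfun (lie x).

Definition lie_span U W : {vspace L} :=
  (<<[seq lie x y | x <- vbasis U, y <- vbasis W]>>)%VS.

Lemma mem_lie_span U W x y : x \in U -> y \in W -> lie x y \in lie_span U W.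
Proof.
move=> xU yW; rewrite (coord_vbasis xU) (coord_vbasis yW) lie_suml.
apply: memv_suml => i _; rewrite raddf_sum; apply: memv_suml => j _ /=.
rewrite lieZl lieZr; do 2!apply: memvZ; apply: memv_span.
by apply/allpairsP; exists ((vbasis U)`_i, (vbasis W)`_j); split => //=;
  rewrite mem_nth ?size_tuple.
Qed.

Fixpoint derived n U :=
  if n is n'.+1 then lie_span (derived n' U) (derived n' U) else U.

Fixpoint lower_central n U :=
  if n is n'.+1 then lie_span U (lower_central n' U) else U.

Definition solvable_space U := exists n, derived n U = 0%VS.
Definition nilpotent_space U := exists n, lower_central n U = 0%VS.

Definition lie_ideal I := forall x y, y \in I -> lie x y \in I.

Definition semisimple := forall I, lie_ideal I -> solvable_space I -> I = 0%VS.

Definition lie_closed U := forall x y, x \in U -> y \in U -> lie x y \in U.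

Record subLie := SubLie { subLie_vs :> {vspace L}; subLieP : lie_closed subLie_vs }.

Definition cartan (h : subLie) :=
  nilpotent_space h /\ forall x, (forall y, y \in h -> lie x y \in h) -> x \in h.

Definition borel (b : subLie) :=
  solvable_space b /\
  forall b' : subLie, solvable_space b' -> (b <= b')%VS -> (b' <= b)%VS.

End LieTheory.

Section SubLieType.
Variables (F : fieldType) (L : lieAlgType F) (A : subLie L).

Definition subLie_of : Type := subvs_of A.
HB.instance Definition _ := Vector.on subLie_of.

Implicit Types x y z : subLie_of.

Definition sub_lie x y : subLie_of := Subvs (subLieP (valP x) (valP y)).

Fact sub_lie_linear x : linear (sub_lie x).
Proof. by move=> a y z; apply: val_inj; rewrite /= lieDr lieZr. Qed.
Fact sub_lie_linearl y : linear (sub_lie^~ y).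
Proof. by move=> a x z; apply: val_inj; rewrite /= lieDl lieZl. Qed.
Fact sub_liexx x : sub_lie x x = 0.
Proof. by apply: val_inj; rewrite /= liexx. Qed.
Fact sub_lie_jacobi x y z :
  sub_lie x (sub_lie y z) + sub_lie y (sub_lie z x) + sub_lie z (sub_lie x y) = 0.
Proof. by apply: val_inj; rewrite /= lie_jacobi. Qed.

HB.instance Definition _ := Vector_isLieAlgebra.Build F subLie_of
  sub_lie_linear sub_lie_linearl sub_liexx sub_lie_jacobi.

Definition sub_val (x : subLie_of) : L := vsval x.

Fact sub_val_linear : linear sub_val. Proof. by []. Qed.
HB.instance Definition _ := GRing.isLinear.Build F subLie_of L _ sub_val sub_val_linear.

Lemma sub_val_lie x y : sub_val (lie x y) = lie (sub_val x) (sub_val y).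
Proof. by []. Qed.

Lemma sub_valP x : sub_val x \in A. Proof. exact: valP. Qed.

End SubLieType.

Section Derived.
Variables (F : fieldType) (L : lieAlgType F) (A : subLie L).

Fact derived_closed : lie_closed (lie_span A A).
Proof.
have sub : (lie_span A A <= A)%VS.
  apply/span_subvP => _ /allpairsP[[x y] [xA yA ->]].
  by apply: subLieP; exact: vbasis_mem.
by move=> x y /(subvP sub) xA /(subvP sub) yA; exact: mem_lie_span.
Qed.

Definition derived_subLie := SubLie derived_closed.
End Derived.

Record lieHom (F : fieldType) (L L' : lieAlgType F) := LieHom {
  lieHom_fun :> {linear L -> L'};
  lieHomP : forall x y, lieHom_fun (lie x y) = lie (lieHom_fun x) (lieHom_fun y)
}.

Definition sub_incl (F : fieldType) (L : lieAlgType F) (A : subLie L) :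
    lieHom (subLie_of A) L :=
  @LieHom F (subLie_of A) L (@sub_val F L A) (fun _ _ => erefl).

(** [Uea L] is the universal enveloping algebra of [L]: the unital associative
  algebra generated by the elements of [L] subject to linearity of the
  generators and [x,y] = xy - yx, i.e. the quotient of the tensor algebra of [L]
  by the usual ideal.  It is the type of formal expressions [uterm] modulo the
  least congruence [ueq] containing the algebra axioms and these relations. *)

Section UeaTerms.
Variables (F : fieldType) (L : lieAlgType F).

Inductive uterm : Type :=
| UGen of L | UZero | UOne | UOpp of uterm | UAdd of uterm & uterm
| UMul of uterm & uterm | UScale of F & uterm.

Inductive ueq : uterm -> uterm -> Prop :=
| ueq_refl s : ueq s s
| ueq_sym s t : ueq s t -> ueq t s
| ueq_trans s t u : ueq s t -> ueq t u -> ueq s u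
| ueq_opp s s' : ueq s s' -> ueq (UOpp s) (UOpp s')
| ueq_add s s' t t' : ueq s s' -> ueq t t' -> ueq (UAdd s t) (UAdd s' t')
| ueq_mul s s' t t' : ueq s s' -> ueq t t' -> ueq (UMul s t) (UMul s' t')
| ueq_scale a s s' : ueq s s' -> ueq (UScale a s) (UScale a s')
| ueq_addA s t u : ueq (UAdd s (UAdd t u)) (UAdd (UAdd s t) u)
| ueq_addC s t : ueq (UAdd s t) (UAdd t s)
| ueq_add0 s : ueq (UAdd UZero s) s
| ueq_addN s : ueq (UAdd (UOpp s) s) UZero
| ueq_mulA s t u : ueq (UMul s (UMul t u)) (UMul (UMul s t) u)
| ueq_mul1l s : ueq (UMul UOne s) s
| ueq_mul1r s : ueq (UMul s UOne) s
| ueq_mulDl s t u : ueq (UMul (UAdd s t) u) (UAdd (UMul s u) (UMul t u))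
| ueq_mulDr s t u : ueq (UMul s (UAdd t u)) (UAdd (UMul s t) (UMul s u))
| ueq_scaleA a b s : ueq (UScale a (UScale b s)) (UScale (a * b) s)
| ueq_scale1 s : ueq (UScale 1 s) s
| ueq_scaleDr a s t : ueq (UScale a (UAdd s t)) (UAdd (UScale a s) (UScale a t))
| ueq_scaleDl a b s : ueq (UScale (a + b) s) (UAdd (UScale a s) (UScale b s))
| ueq_scaleAl a s t : ueq (UScale a (UMul s t)) (UMul (UScale a s) t)
| ueq_scaleAr a s t : ueq (UScale a (UMul s t)) (UMul s (UScale a t))
| ueq_gen_linear a x y : ueq (UGen (a *: x + y)) (UAdd (UScale a (UGen x)) (UGen y))
| ueq_gen_lie x y : ueq (UGen (lie x y))
    (UAdd (UMul (UGen x) (UGen y)) (UOpp (UMul (UGen y) (UGen x)))).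

HB.instance Definition _ := gen_eqMixin uterm.
HB.instance Definition _ := gen_choiceMixin uterm.

Definition ueqb (s t : uterm) := `[< ueq s t >].

Fact ueqb_refl : reflexive ueqb.
Proof. by move=> s; apply/asboolP; exact: ueq_refl. Qed.
Fact ueqb_sym : symmetric ueqb.
Proof. by move=> s t; apply/asboolP/asboolP => /ueq_sym. Qed.
Fact ueqb_trans : transitive ueqb.
Proof.
by move=> t s u /asboolP st /asboolP tu; apply/asboolP; exact: ueq_trans st tu.
Qed.

Canonical ueq_equiv := EquivRel ueqb ueqb_refl ueqb_sym ueqb_trans.

Definition Uea : Type := {eq_quot ueq_equiv}.
HB.instance Definition _ := Choice.on Uea.

Definition uclass (s : uterm) : Uea := \pi_({eq_quot ueq_equiv}) s.
Definition urep (u : Uea) : uterm := repr (u : {eq_quot ueq_equiv}).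

Lemma urepK : cancel urep uclass.
Proof. by move=> u; rewrite /uclass /urep reprK. Qed.

Lemma uclassP s t : uclass s = uclass t <-> ueq s t.
Proof. by split => [/eqmodP/asboolP|st]; last exact/eqmodP/asboolP. Qed.

Lemma urep_class s : ueq (urep (uclass s)) s.
Proof. by apply/uclassP; rewrite urepK. Qed.

Definition uea_opp (u : Uea) := uclass (UOpp (urep u)).
Definition uea_add (u v : Uea) := uclass (UAdd (urep u) (urep v)).
Definition uea_mul (u v : Uea) := uclass (UMul (urep u) (urep v)).
Definition uea_scale a (u : Uea) := uclass (UScale a (urep u)).

Lemma uclass_opp s : uea_opp (uclass s) = uclass (UOpp s).
Proof. exact/uclassP/ueq_opp/urep_class. Qed.
Lemma uclass_add s t : uea_add (uclass s) (uclass t) = uclass (UAdd s t).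
Proof. by apply/uclassP/ueq_add; exact: urep_class. Qed.
Lemma uclass_mul s t : uea_mul (uclass s) (uclass t) = uclass (UMul s t).
Proof. by apply/uclassP/ueq_mul; exact: urep_class. Qed.
Lemma uclass_scale a s : uea_scale a (uclass s) = uclass (UScale a s).
Proof. exact/uclassP/ueq_scale/urep_class. Qed.

Lemma uclassW (P : Uea -> Prop) : (forall s, P (uclass s)) -> forall u, P u.
Proof. by move=> Ps u; rewrite -(urepK u). Qed.

Let uE := (uclass_opp, uclass_add, uclass_mul, uclass_scale).

Fact uea_addA : associative uea_add.
Proof.
elim/uclassW=> s; elim/uclassW=> t; elim/uclassW=> u; rewrite !uE.
exact/uclassP/ueq_addA.
Qed.
Fact uea_addC : commutative uea_add.
Proof.
by elim/uclassW=> s; elim/uclassW=> t; rewrite !uE; exact/uclassP/ueq_addC.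
Qed.
Fact uea_add0 : left_id (uclass UZero) uea_add.
Proof. by elim/uclassW=> s; rewrite !uE; exact/uclassP/ueq_add0. Qed.
Fact uea_addN : left_inverse (uclass UZero) uea_opp uea_add.
Proof. by elim/uclassW=> s; rewrite !uE; exact/uclassP/ueq_addN. Qed.

HB.instance Definition _ :=
  GRing.isZmodule.Build Uea uea_addA uea_addC uea_add0 uea_addN.

Fact uea_mulA : associative uea_mul.
Proof.
elim/uclassW=> s; elim/uclassW=> t; elim/uclassW=> u; rewrite !uE.
exact/uclassP/ueq_mulA.
Qed.
Fact uea_mul1l : left_id (uclass UOne) uea_mul.
Proof. by elim/uclassW=> s; rewrite !uE; exact/uclassP/ueq_mul1l. Qed.
Fact uea_mul1r : right_id (uclass UOne) uea_mul.
Proof. by elim/uclassW=> s; rewrite !uE; exact/uclassP/ueq_mul1r. Qed.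
Fact uea_mulDl : left_distributive uea_mul +%R.
Proof.
elim/uclassW=> s; elim/uclassW=> t; elim/uclassW=> u; rewrite /+%R /= !uE.
exact/uclassP/ueq_mulDl.
Qed.
Fact uea_mulDr : right_distributive uea_mul +%R.
Proof.
elim/uclassW=> s; elim/uclassW=> t; elim/uclassW=> u; rewrite /+%R /= !uE.
exact/uclassP/ueq_mulDr.
Qed.

Fixpoint ueval (A : algType F) (f : L -> A) (s : uterm) : A :=
  match s with
  | UGen x => f x
  | UZero => 0
  | UOne => 1
  | UOpp s => - ueval f s
  | UAdd s t => ueval f s + ueval f t
  | UMul s t => ueval f s * ueval f t
  | UScale a s => a *: ueval f s
  end.

Lemma ueval_ueq (A : algType F) (f : {linear L -> A}) :
  (forall x y, f (lie x y) = f x * f y - f y * f x) ->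
  forall s t, ueq s t -> ueval f s = ueval f t.
Proof.
move=> fP s t; elim=> //=.
- by move=> ? ? ? _ -> _ ->.
- by move=> ? ? _ ->.
- by move=> ? ? ? ? _ -> _ ->.
- by move=> ? ? ? ? _ -> _ ->.
- by move=> ? ? ? _ ->.
- by move=> *; rewrite addrA.
- by move=> *; rewrite addrC.
- by move=> *; rewrite add0r.
- by move=> *; rewrite addNr.
- by move=> *; rewrite mulrA.
- by move=> *; rewrite mul1r.
- by move=> *; rewrite mulr1.
- by move=> *; rewrite mulrDl.
- by move=> *; rewrite mulrDr.
- by move=> *; rewrite scalerA.
- by move=> *; rewrite scale1r.
- by move=> *; rewrite scalerDr.
- by move=> *; rewrite scalerDl.
- by move=> *; rewrite scalerAl.
- by move=> *; rewrite scalerAr.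
- by move=> *; rewrite linearP.
Qed.

Fact uea_one_neq0 : uclass UOne != uclass UZero.
Proof.
apply/eqP => /uclassP /(@ueval_ueq F^o (\0 : {linear L -> F^o})) /=.
have H0 (x y : L) : 0 = 0 * 0 - 0 * 0 :> F by rewrite mul0r subr0.
by move=> /(_ H0)/eqP; rewrite oner_eq0.
Qed.

HB.instance Definition _ := GRing.Zmodule_isNzRing.Build Uea
  uea_mulA uea_mul1l uea_mul1r uea_mulDl uea_mulDr uea_one_neq0.

Fact uea_scaleA a b u : uea_scale a (uea_scale b u) = uea_scale (a * b) u.
Proof. by elim/uclassW: u => s; rewrite !uE; exact/uclassP/ueq_scaleA. Qed.
Fact uea_scale1 : left_id 1 uea_scale.
Proof. by elim/uclassW=> s; rewrite !uE; exact/uclassP/ueq_scale1. Qed.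
Fact uea_scaleDr : right_distributive uea_scale +%R.
Proof.
move=> a; elim/uclassW=> s; elim/uclassW=> t; rewrite /+%R /= !uE.
exact/uclassP/ueq_scaleDr.
Qed.
Fact uea_scaleDl u : {morph uea_scale^~ u : a b / a + b}.
Proof.
move=> a b; elim/uclassW: u => s; rewrite [in RHS]/+%R /= !uE.
exact/uclassP/ueq_scaleDl.
Qed.

HB.instance Definition _ := GRing.Zmodule_isLmodule.Build F Uea
  uea_scaleA uea_scale1 uea_scaleDr uea_scaleDl.

Fact uea_scaleAl a (u v : Uea) : a *: (u * v) = a *: u * v.
Proof.
elim/uclassW: u => s; elim/uclassW: v => t; rewrite /*:%R /*%R /= !uE.
exact/uclassP/ueq_scaleAl.
Qed.
HB.instance Definition _ := GRing.Lmodule_isLalgebra.Build F Uea uea_scaleAl.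

Fact uea_scaleAr a (u v : Uea) : a *: (u * v) = u * (a *: v).
Proof.
elim/uclassW: u => s; elim/uclassW: v => t; rewrite /*:%R /*%R /= !uE.
exact/uclassP/ueq_scaleAr.
Qed.
HB.instance Definition _ := GRing.Lalgebra_isAlgebra.Build F Uea uea_scaleAr.

Lemma uclass0 : uclass UZero = 0. Proof. by []. Qed.
Lemma uclass1 : uclass UOne = 1. Proof. by []. Qed.
Lemma uclassN s : uclass (UOpp s) = - uclass s.
Proof. by rewrite -uclass_opp. Qed.
Lemma uclassD s t : uclass (UAdd s t) = uclass s + uclass t.
Proof. by rewrite -uclass_add. Qed.
Lemma uclassM s t : uclass (UMul s t) = uclass s * uclass t.
Proof. by rewrite -uclass_mul. Qed.
Lemma uclassZ a s : uclass (UScale a s) = a *: uclass s.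
Proof. by rewrite -uclass_scale. Qed.

Definition uea_in (x : L) : Uea := uclass (UGen x).

Fact uea_in_linear : linear uea_in.
Proof.
move=> a x y; rewrite /uea_in /+%R /*:%R /= !uE; exact/uclassP/ueq_gen_linear.
Qed.
HB.instance Definition _ := GRing.isLinear.Build F L Uea _ uea_in uea_in_linear.

Lemma uea_in_lie x y :
  uea_in (lie x y) = uea_in x * uea_in y - uea_in y * uea_in x.
Proof.
rewrite /uea_in /+%R /*%R /-%R /= !uE; exact/uclassP/ueq_gen_lie.
Qed.

End UeaTerms.

Section UeaLift.
Variables (F : fieldType) (L : lieAlgType F) (A : algType F).
Variable f : {linear L -> A}.
Hypothesis fP : forall x y, f (lie x y) = f x * f y - f y * f x.

Definition uea_lift of (forall x y, f (lie x y) = f x * f y - f y * f x) :=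
  fun u : Uea L => ueval f (urep u).

Local Notation lft := (uea_lift fP).

Lemma uea_lift_class s : lft (uclass s) = ueval f s.
Proof. exact: (ueval_ueq fP (urep_class s)). Qed.

Lemma uea_liftE x : lft (uea_in x) = f x.
Proof. exact: uea_lift_class. Qed.

Fact uea_lift_linear : linear lft.
Proof.
move=> a; elim/uclassW=> s; elim/uclassW=> t.
by rewrite /+%R /*:%R /= uclass_scale uclass_add !uea_lift_class.
Qed.
Fact uea_lift_multiplicative : monoid_morphism lft.
Proof.
split; first exact: uea_lift_class.
elim/uclassW=> s; elim/uclassW=> t.
by rewrite /*%R /= uclass_mul !uea_lift_class.
Qed.

HB.instance Definition _ := GRing.isLinear.Build F (Uea L) A _ lft uea_lift_linear.
HB.instance Definition _ :=
  GRing.isMonoidMorphism.Build (Uea L) A lft uea_lift_multiplicative.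

Lemma uea_lift_unique (g : {lrmorphism Uea L -> A}) :
  (forall x, g (uea_in x) = f x) -> g =1 lft.
Proof.
move=> gf; elim/uclassW=> s; rewrite uea_lift_class; elim: s => //=.
- by rewrite uclass0 raddf0.
- by rewrite uclass1 rmorph1.
- by move=> s <-; rewrite uclassN raddfN.
- by move=> s <- t <-; rewrite uclassD raddfD.
- by move=> s <- t <-; rewrite uclassM rmorphM.
- by move=> a s <-; rewrite uclassZ linearZ.
Qed.

End UeaLift.

Section UeaMap.
Variables (F : fieldType) (L L' : lieAlgType F) (f : lieHom L L').

Definition uea_map_gen (x : L) : Uea L' := uea_in (f x).
Fact uea_map_gen_linear : linear uea_map_gen.
Proof. by move=> a x y; rewrite /uea_map_gen !linearP. Qed.
HB.instance Definition _ :=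
  GRing.isLinear.Build F L (Uea L') _ uea_map_gen uea_map_gen_linear.
Fact uea_map_gen_lie x y : uea_map_gen (lie x y) =
  uea_map_gen x * uea_map_gen y - uea_map_gen y * uea_map_gen x.
Proof. by rewrite /uea_map_gen lieHomP uea_in_lie. Qed.

Definition uea_map : {lrmorphism Uea L -> Uea L'} := uea_lift uea_map_gen_lie.

Lemma uea_map_in x : uea_map (uea_in x) = uea_in (f x).
Proof. exact: uea_liftE. Qed.

End UeaMap.

Section ResMod.
Variables (A B : nzRingType) (phi : {rmorphism A -> B}) (V : lmodType B).

Definition resmod of {rmorphism A -> B} : Type := V.
HB.instance Definition _ := GRing.Zmodule.on (resmod phi).

Definition res_scale (a : A) (v : resmod phi) : resmod phi := phi a *: (v : V).
Fact res_scaleA a b v : res_scale a (res_scale b v) = res_scale (a * b) v.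
Proof. by rewrite /res_scale scalerA rmorphM. Qed.
Fact res_scale1 : left_id 1 res_scale.
Proof. by move=> v; rewrite /res_scale rmorph1 scale1r. Qed.
Fact res_scaleDr : right_distributive res_scale +%R.
Proof. by move=> a u v; rewrite /res_scale scalerDr. Qed.
Fact res_scaleDl v : {morph res_scale^~ v : a b / a + b}.
Proof. by move=> a b; rewrite /res_scale raddfD scalerDl. Qed.
HB.instance Definition _ := GRing.Zmodule_isLmodule.Build A (resmod phi)
  res_scaleA res_scale1 res_scaleDr res_scaleDl.
End ResMod.

(** [extmod phi V] is [B ⊗_A V] for [B] regarded as a right [A]-module through
  [phi]: the abelian group generated by the symbols [b ⊗ v] ([TPure b v])
  subject to biadditivity and [(b * phi a) ⊗ v = b ⊗ (a *: v)]. *)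

Section ExtMod.
Variables (A B : nzRingType) (phi : {rmorphism A -> B}) (V : lmodType A).

Inductive tterm : Type :=
| TPure of B & V | TZero | TOpp of tterm | TAdd of tterm & tterm.

Inductive teq : tterm -> tterm -> Prop :=
| teq_refl s : teq s s
| teq_sym s t : teq s t -> teq t s
| teq_trans s t u : teq s t -> teq t u -> teq s u
| teq_opp s s' : teq s s' -> teq (TOpp s) (TOpp s')
| teq_add s s' t t' : teq s s' -> teq t t' -> teq (TAdd s t) (TAdd s' t')
| teq_addA s t u : teq (TAdd s (TAdd t u)) (TAdd (TAdd s t) u)
| teq_addC s t : teq (TAdd s t) (TAdd t s)
| teq_add0 s : teq (TAdd TZero s) s
| teq_addN s : teq (TAdd (TOpp s) s) TZero
| teq_pureDl b c v : teq (TPure (b + c) v) (TAdd (TPure b v) (TPure c v))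
| teq_pureDr b v w : teq (TPure b (v + w)) (TAdd (TPure b v) (TPure b w))
| teq_balanced b a v : teq (TPure (b * phi a) v) (TPure b (a *: v)).

HB.instance Definition _ := gen_eqMixin tterm.
HB.instance Definition _ := gen_choiceMixin tterm.

Definition teqb (s t : tterm) := `[< teq s t >].

Fact teqb_refl : reflexive teqb.
Proof. by move=> s; apply/asboolP; exact: teq_refl. Qed.
Fact teqb_sym : symmetric teqb.
Proof. by move=> s t; apply/asboolP/asboolP => /teq_sym. Qed.
Fact teqb_trans : transitive teqb.
Proof.
by move=> t s u /asboolP st /asboolP tu; apply/asboolP; exact: teq_trans st tu.
Qed.

Canonical teq_equiv := EquivRel teqb teqb_refl teqb_sym teqb_trans.

Definition extmod : Type := {eq_quot teq_equiv}.
HB.instance Definition _ := Choice.on extmod.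

Definition tclass (s : tterm) : extmod := \pi_({eq_quot teq_equiv}) s.
Definition trep (u : extmod) : tterm := repr (u : {eq_quot teq_equiv}).

Lemma trepK : cancel trep tclass.
Proof. by move=> u; rewrite /tclass /trep reprK. Qed.

Lemma tclassP s t : tclass s = tclass t <-> teq s t.
Proof. by split => [/eqmodP/asboolP|st]; last exact/eqmodP/asboolP. Qed.

Lemma trep_class s : teq (trep (tclass s)) s.
Proof. by apply/tclassP; rewrite trepK. Qed.

Fixpoint tscale (b : B) (s : tterm) : tterm :=
  match s with
  | TPure c v => TPure (b * c) v
  | TZero => TZero
  | TOpp s => TOpp (tscale b s)
  | TAdd s t => TAdd (tscale b s) (tscale b t)
  end.

Lemma teq_tscale b s t : teq s t -> teq (tscale b s) (tscale b t).
Proof.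
elim=> /= [s'|s' t' _|s' t' u _ st _|s' t' _|s' s'' t' t'' _ ? _
  |s' t' u|s' t'|s'|s'|c d v|c v w|c a v].
- exact: teq_refl.
- exact: teq_sym.
- exact: teq_trans.
- exact: teq_opp.
- exact: teq_add.
- exact: teq_addA.
- exact: teq_addC.
- exact: teq_add0.
- exact: teq_addN.
- by rewrite mulrDr; exact: teq_pureDl.
- exact: teq_pureDr.
- by rewrite mulrA; exact: teq_balanced.
Qed.

Definition ext_opp (u : extmod) := tclass (TOpp (trep u)).
Definition ext_add (u v : extmod) := tclass (TAdd (trep u) (trep v)).
Definition ext_scale b (u : extmod) := tclass (tscale b (trep u)).

Lemma tclass_opp s : ext_opp (tclass s) = tclass (TOpp s).
Proof. exact/tclassP/teq_opp/trep_class. Qed.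
Lemma tclass_add s t : ext_add (tclass s) (tclass t) = tclass (TAdd s t).
Proof. by apply/tclassP/teq_add; exact: trep_class. Qed.
Lemma tclass_scale b s : ext_scale b (tclass s) = tclass (tscale b s).
Proof. exact/tclassP/teq_tscale/trep_class. Qed.

Lemma tclassW (P : extmod -> Prop) : (forall s, P (tclass s)) -> forall u, P u.
Proof. by move=> Ps u; rewrite -(trepK u). Qed.

Let tE := (tclass_opp, tclass_add, tclass_scale).

Fact ext_addA : associative ext_add.
Proof.
elim/tclassW=> s; elim/tclassW=> t; elim/tclassW=> u; rewrite !tE.
exact/tclassP/teq_addA.
Qed.
Fact ext_addC : commutative ext_add.
Proof.
by elim/tclassW=> s; elim/tclassW=> t; rewrite !tE; exact/tclassP/teq_addC.
Qed.
Fact ext_add0 : left_id (tclass TZero) ext_add.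
Proof. by elim/tclassW=> s; rewrite !tE; exact/tclassP/teq_add0. Qed.
Fact ext_addN : left_inverse (tclass TZero) ext_opp ext_add.
Proof. by elim/tclassW=> s; rewrite !tE; exact/tclassP/teq_addN. Qed.

HB.instance Definition _ :=
  GRing.isZmodule.Build extmod ext_addA ext_addC ext_add0 ext_addN.

Fact ext_scaleA b c u : ext_scale b (ext_scale c u) = ext_scale (b * c) u.
Proof.
elim/tclassW: u => s; rewrite !tE; congr tclass.
by elim: s => //= [d v|s ->|s -> t ->] //; rewrite mulrA.
Qed.
Fact ext_scale1 : left_id 1 ext_scale.
Proof.
elim/tclassW => s; rewrite !tE; congr tclass.
by elim: s => //= [d v|s ->|s -> t ->] //; rewrite mul1r.
Qed.
Fact ext_scaleDr : right_distributive ext_scale +%R.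
Proof.
by move=> b; elim/tclassW=> s; elim/tclassW=> t; rewrite /+%R /= !tE.
Qed.
Lemma tclass0 : tclass TZero = 0. Proof. by []. Qed.
Lemma tclassN s : tclass (TOpp s) = - tclass s.
Proof. by rewrite -tclass_opp. Qed.
Lemma tclassD s t : tclass (TAdd s t) = tclass s + tclass t.
Proof. by rewrite -tclass_add. Qed.

Fact ext_scaleDl u : {morph ext_scale^~ u : b c / b + c}.
Proof.
move=> b c; elim/tclassW: u; elim=> [d v||s|s IHs t IHt]; rewrite !tE /=.
- by rewrite mulrDl -tclassD; exact/tclassP/teq_pureDl.
- by rewrite tclass0 addr0.
- by rewrite !tclassN => ->; rewrite opprD.
- by move: IHs IHt; rewrite !tE !tclassD => -> ->; rewrite addrACA.
Qed.

HB.instance Definition _ := GRing.Zmodule_isLmodule.Build B extmod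
  ext_scaleA ext_scale1 ext_scaleDr ext_scaleDl.

Definition tensor (b : B) (v : V) : extmod := tclass (TPure b v).

Lemma tensorDl b c v : tensor (b + c) v = tensor b v + tensor c v.
Proof. by rewrite -tclassD; exact/tclassP/teq_pureDl. Qed.
Lemma tensorDr b v w : tensor b (v + w) = tensor b v + tensor b w.
Proof. by rewrite -tclassD; exact/tclassP/teq_pureDr. Qed.
Lemma tensor_balanced b a v : tensor (b * phi a) v = tensor b (a *: v).
Proof. exact/tclassP/teq_balanced. Qed.
Lemma tensorZ b c v : b *: tensor c v = tensor (b * c) v.
Proof. exact: tclass_scale. Qed.

End ExtMod.

Definition simple_module (A : nzRingType) (X : lmodType A) :=
  (exists v : X, v != 0) /\
  forall W : {pred X}, submod_closed W ->
    (forall v, v \in W -> v = 0) \/ (forall v, v \in W).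

Definition fin_gen_module (A : nzRingType) (X : lmodType A) :=
  exists s : seq X, forall v : X,
    exists c : 'I_(size s) -> A, v = \sum_(i < size s) c i *: s`_i.

Definition antiautomorphism (F : fieldType) (A : algType F) (tau : A -> A) :=
  [/\ linear tau, bijective tau, tau 1 = 1 &
      forall u v, tau (u * v) = tau v * tau u].

Section ContravariantForms.
Variables (F : fieldType) (A : algType F) (tau : A -> A) (X : lmodType A).

(* The scalar [a : F] acts on the [A]-module [X] through [a%:A : A]. *)
Definition is_contravariant (f : X -> X -> F^o) :=
  [/\ forall w a u v, f (a%:A *: u + v) w = a * f u w + f v w,
      forall u a v w, f u (a%:A *: v + w) = a * f u v + f u w,
      forall v w, f v w = f w v &
      forall u v w, f (u *: v) w = f v (tau u *: w)].

Definition contravariant : {pred X -> X -> F^o} :=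
  [pred f | `[< is_contravariant f >]].

Fact contravariant_submod : submod_closed contravariant.
Proof.
split; first by apply/asboolP; split => *; rewrite /0%R /= ?mulr0 ?addr0.
move=> c f g /asboolP[fl fr fs fc] /asboolP[gl gr gs gc].
have E v w : (c *: f + g) v w = c * f v w + g v w by [].
apply/asboolP; split => *; rewrite !E.
- by rewrite fl gl; rewrite !mulrDr addrACA mulrCA.
- by rewrite fr gr; rewrite !mulrDr addrACA mulrCA.
- by rewrite fs gs.
- by rewrite fc gc.
Qed.

HB.instance Definition _ := GRing.isSubmodClosed.Build F (X -> X -> F^o)
  contravariant contravariant_submod.

Record contraForm := ContraForm {
  contra_fun :> X -> X -> F^o;
  contra_funP : contra_fun \in contravariant
}.
HB.instance Definition _ := [isSub for contra_fun].
HB.instance Definition _ := [Choice of contraForm by <:].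
HB.instance Definition _ := [SubChoice_isSubLmodule of contraForm by <:].

End ContravariantForms.

Definition nat_span (V : zmodType) (s : seq V) (v : V) :=
  exists m : V -> nat, v = \sum_(b <- s) b *+ m b.

Definition int_span (V : zmodType) (s : seq V) (v : V) :=
  exists m : V -> int, v = \sum_(b <- s) b *~ m b.

Section RootSpaces.
Variables (F : numFieldType) (L : lieAlgType F) (h : subLie L).

Definition hdual := 'Hom(subLie_of h, F^o).
HB.instance Definition _ := Vector.on hdual.

Implicit Types (a b : hdual) (x y : L) (k : subLie_of h).

Definition rootspace a : {vspace L} :=
  (\bigcap_(k <- vbasis {:subLie_of h}) passmx.leigenspace (ad (sub_val k)) (a k))%VS.

Lemma rootspaceP a x :
  reflect (forall k, lie (sub_val k) x = a k *: x) (x \in rootspace a).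
Proof.
have capP (s : seq (subLie_of h)) :
    x \in (\bigcap_(k <- s) passmx.leigenspace (ad (sub_val k)) (a k))%VS =
    all (fun k => lie (sub_val k) x == a k *: x) s.
  elim: s => [|k s IH]; first by rewrite big_nil memvf.
  rewrite big_cons memv_cap IH /= memv_ker; congr (_ && _).
  by rewrite add_lfunE opp_lfunE scale_lfunE id_lfunE lfunE subr_eq0.
rewrite /rootspace capP; apply: (iffP allP) => [H k|H k _]; last exact/eqP.
rewrite (coord_vbasis (memvf k)) !raddf_sum lie_suml scaler_suml.
apply: eq_bigr => i _.
set e := (vbasis _)`_i; set c := coord _ _ _.
have /H/eqP He : e \in vbasis {:subLie_of h} by rewrite mem_nth ?size_tuple.
rewrite /=.
by rewrite !linearZ /= lieZl He -[in RHS]scalerA.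
Qed.

Definition is_root a := a != 0 /\ rootspace a != 0%VS.

Lemma lie_rootspace a b x y :
  x \in rootspace a -> y \in rootspace b -> lie x y \in rootspace (a + b).
Proof.
move=> /rootspaceP xa /rootspaceP yb; apply/rootspaceP => k.
by rewrite lie_leibniz xa yb lieZl lieZr -scalerDl add_lfunE.
Qed.

Lemma rootspace_cartan x : cartan h -> x \in rootspace 0 -> x \in h.
Proof.
move=> [_ nh] /rootspaceP x0; apply: nh => y yh.
by rewrite lieC (x0 (Subvs yh)) zero_lfunE scale0r oppr0 mem0v.
Qed.

Lemma rootspace_cases a x : cartan h -> x \in rootspace a ->
  [\/ x = 0, a = 0 /\ x \in h | is_root a].
Proof.
move=> hC xa; have [->|x0] := eqVneq x 0; first exact: Or31.
have [a0|a0] := eqVneq a 0.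
  by apply: Or32; split => //; apply: rootspace_cartan => //; rewrite -a0.
apply: Or33; split => //; apply/eqP => z.
by move: xa; rewrite z memv0 (negPf x0).
Qed.

Lemma mem_sum_seq (I : eqType) (s : seq I) (U : I -> {vspace L}) x :
  uniq s -> x \in (\sum_(i <- s) U i)%VS ->
  exists2 v : I -> L, (forall i, i \in s -> v i \in U i) & x = \sum_(i <- s) v i.
Proof.
elim: s x => [|i s IH] x /=.
  by rewrite big_nil memv0 => _ /eqP ->; exists (fun=> 0); rewrite ?big_nil.
case/andP=> iNs us; rewrite big_cons => /memv_addP[u Uu [w /(IH _ us)[v vU ->] ->]].
exists (fun j => if j == i then u else v j).
  move=> j; rewrite inE; case: eqP => [-> _ //|_ /=]; exact: vU.
rewrite big_cons eqxx; congr (_ + _); apply: eq_big_seq => j js.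
by case: eqP js => // ->; rewrite (negPf iNs).
Qed.

Lemma memv_sum_seq (I : eqType) (s : seq I) (U : I -> {vspace L}) i x :
  i \in s -> x \in U i -> x \in (\sum_(i <- s) U i)%VS.
Proof.
elim: s => // j s IH; rewrite inE big_cons => /orP[/eqP <- xU|/IH H /H xs].
  by rewrite -[x]addr0 memv_add ?mem0v.
by rewrite -[x]add0r memv_add ?mem0v.
Qed.

Lemma lie_sum_sub (I : eqType) (s : seq I) (U : I -> {vspace L})
    (T : {vspace L}) x y :
  (forall i z, i \in s -> z \in U i -> lie z y \in T) ->
  x \in (\sum_(i <- s) U i)%VS -> lie x y \in T.
Proof.
elim: s x => [|i s IH] x H.
  by rewrite big_nil memv0 => /eqP ->; rewrite lie0l mem0v.
rewrite big_cons => /memv_addP[u Uu [w ws ->]]; rewrite lieDl memvD //.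
  by apply: H Uu; rewrite mem_head.
by apply: IH ws => j z js; apply: H; rewrite inE js orbT.
Qed.

Lemma weight_free (s : seq hdual) (v : hdual -> L) :
  uniq s -> (forall a, a \in s -> v a \in rootspace a) ->
  \sum_(a <- s) v a = 0 -> forall a, a \in s -> v a = 0.
Proof.
elim: s v => // m s IH v /= /andP[ms us] vs; rewrite big_cons => sum0.
have tail0 a : a \in s -> v a = 0.
  move=> as_.
  have [k mk] : exists k, m k != a k.
    apply: contrapT => /forallNP H; case/negP: ms; suff -> : m = a by [].
    by apply/lfunP => k; apply/eqP; have /negP := H k; rewrite negbK.
  have H := IH (fun b => (b k - m k) *: v b) us.
  have : (a k - m k) *: v a = 0.
    apply: H => // [b bs|].
      by apply: memvZ; apply: vs; rewrite inE bs orbT.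
    have : lie (sub_val k) (v m + \sum_(b <- s) v b) =
           m k *: (v m + \sum_(b <- s) v b).
      by rewrite sum0 scaler0 raddf0.
    rewrite lieDr scalerDr raddf_sum /= scaler_sumr.
    have /rootspaceP -> := vs m (mem_head _ _).
    move/addrI/eqP; rewrite -subr_eq0 -sumrB => /eqP E; rewrite -[RHS]E.
    apply: eq_big_seq => b bs.
    have /rootspaceP -> : v b \in rootspace b by apply: vs; rewrite inE bs orbT.
    by rewrite scalerBl.
  by move/eqP; rewrite scaler_eq0 subr_eq0 eq_sym (negPf mk) => /eqP.
move=> a; rewrite inE => /orP[/eqP ->|]; last exact: tail0.
by move: sum0; rewrite big1_seq ?addr0 // => b /tail0.
Qed.

Lemma cartan_ad_nilp : cartan h ->
  exists n, forall k x, x \in h -> iter n (lie (sub_val k)) x = 0.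
Proof.
move=> [[n hn] _]; exists n => k x xh.
suff : iter n (lie (sub_val k)) x \in lower_central n h.
  by rewrite hn memv0 => /eqP.
by elim: n {hn} => //= n IH; apply: mem_lie_span => //; exact: sub_valP.
Qed.

Lemma iter_rootspace n k a x : x \in rootspace a ->
  iter n (lie (sub_val k)) x = a k ^+ n *: x.
Proof.
move=> xa; elim: n => [|n IH] /=; first by rewrite expr0 scale1r.
by rewrite IH lieZr; have /rootspaceP -> := xa; rewrite scalerA exprSr.
Qed.

Lemma disjoint_root_sums (s t : seq hdual) :
  cartan h -> uniq (s ++ t) -> 0 \notin s ++ t ->
  ((h + \sum_(a <- s) rootspace a) :&: \sum_(a <- t) rootspace a = 0)%VS.
Proof.
move=> hC ust n0; apply/eqP; rewrite -subv0; apply/subvP => x.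
rewrite memv_cap memv0 => /andP[/memv_addP[x0 x0h [x1 x1s ->]]].
move: (ust); rewrite cat_uniq => /and3P[us st ut].
have {x1s}[v vs ->] := mem_sum_seq us x1s.
move/(mem_sum_seq ut) => [w wt E].
pose u a := if a \in s then v a else - w a.
have u_in a : a \in s ++ t -> u a \in rootspace a.
  by rewrite mem_cat /u; case: ifP => [/vs//|_ /wt wa]; rewrite memvN.
have E0 : x0 + \sum_(a <- s ++ t) u a = 0.
  rewrite big_cat /= (eq_big_seq v); last by move=> a; rewrite /u => ->.
  rewrite [X in _ + (_ + X)](eq_big_seq (fun a => - w a)); last first.
    move=> a at_; rewrite /u ifF //; apply/negP => as_.
    by case/hasP: st; exists a.
  by rewrite sumrN addrA E subrr.
have [n nilp] := cartan_ad_nilp hC.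
have u0 a : a \in s ++ t -> u a = 0.
  move=> ast.
  have [k ak] : exists k, a k != 0.
    apply: contrapT => /forallNP H; case/negP: n0; suff <- : a = 0 by [].
    apply/lfunP => k; rewrite zero_lfunE; apply/eqP.
    by have /negP := H k; rewrite negbK.
  have : a k ^+ n *: u a = 0.
    apply: (@weight_free (s ++ t) (fun b => b k ^+ n *: u b)) => //.
      by move=> b /u_in; exact: memvZ.
    have iterD m y z : iter m (lie (sub_val k)) (y + z) =
        iter m (lie (sub_val k)) y + iter m (lie (sub_val k)) z.
      by elim: m => //= m ->; rewrite lieDr.
    have iter0 m : iter m (lie (sub_val k)) 0 = 0 by elim: m => //= m ->; rewrite raddf0.
    have := congr1 (iter n (lie (sub_val k))) E0.
    rewrite iterD nilp // add0r iter0 (big_morph _ (iterD n) (iter0 n)) => E1.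
    rewrite -[RHS]E1.
    by apply: eq_big_seq => b /u_in/iter_rootspace ->.
  by move/eqP; rewrite scaler_eq0 expf_eq0 (negPf ak) andbF => /eqP.
have w0 : \sum_(a <- t) w a = 0.
  rewrite big1_seq // => a /= at_.
  have /u0 : a \in s ++ t by rewrite mem_cat at_ orbT.
  rewrite /u ifF => [/eqP|]; first by rewrite oppr_eq0 => /eqP.
  by apply/negP => as_; case/hasP: st; exists a.
by rewrite E w0.
Qed.

End RootSpaces.

(* [rs_roots] lists the roots of [L] with respect to [rs_h], and [rs_simple] is
   the base of this root system whose positive roots (the roots that are
   combinations of [rs_simple] with natural coefficients) are those with root
   space in [rs_b]. *)
Record rootSetup (F : numFieldType) (L : lieAlgType F) := RootSetup {
  rs_h : subLie L;
  rs_b : subLie L;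
  rs_cartan : cartan rs_h;
  rs_borel : borel rs_b;
  rs_sub : (rs_h <= rs_b)%VS;
  rs_roots : seq (hdual rs_h);
  rs_roots_uniq : uniq rs_roots;
  rs_rootsP : forall a, a \in rs_roots <-> is_root a;
  rs_simple : seq (hdual rs_h);
  rs_simple_sub : {subset rs_simple <= rs_roots};
  rs_simple_free : free rs_simple;
  rs_signed : forall a, a \in rs_roots ->
    nat_span rs_simple a \/ nat_span rs_simple (- a);
  rs_pos_borel : forall a, a \in rs_roots ->
    nat_span rs_simple a <-> (rootspace a <= rs_b)%VS
}.

Section Parabolic.
Variables (F : numFieldType) (L : lieAlgType F) (D : rootSetup L).

Let h := rs_h D.
Local Notation g_ := (@rootspace F L (rs_h D)).

Definition pos_roots : seq (hdual (rs_h D)) :=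
  [seq a <- rs_roots D | `[< nat_span (rs_simple D) a >]].

Definition borel_nil : subLie L := derived_subLie (rs_b D).

Variable eta : 'Hom(subLie_of borel_nil, F^o).

Definition simple_eta : seq (hdual (rs_h D)) :=
  [seq a <- rs_simple D |
    `[< exists x : subLie_of borel_nil, sub_val x \in g_ a /\ eta x != 0 >]].

Definition roots_eta : seq (hdual (rs_h D)) :=
  [seq a <- rs_roots D | `[< int_span simple_eta a >]].

Definition pos_roots_eta : seq (hdual (rs_h D)) :=
  [seq a <- pos_roots | a \in roots_eta].

Definition levi_space : {vspace L} := (rs_h D + \sum_(a <- roots_eta) g_ a)%VS.

Definition n_eta : {vspace L} := (\sum_(a <- pos_roots_eta) g_ a)%VS.

Definition nilrad_eta : {vspace L} :=
  (\sum_(a <- pos_roots | a \notin roots_eta) g_ a)%VS.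

Definition parabolic_space : {vspace L} := (levi_space + nilrad_eta)%VS.

Let nil_roots := [seq a <- pos_roots | a \notin roots_eta].

Let nilrad_etaE : nilrad_eta = (\sum_(a <- nil_roots) g_ a)%VS.
Proof. by rewrite /nilrad_eta big_filter. Qed.

Lemma free_coef (s : seq (hdual h)) (m : hdual h -> F) : free s ->
  \sum_(b <- s) m b *: b = 0 -> forall b, b \in s -> m b = 0.
Proof.
move=> fs E b /(nthP 0)[i i_s <-].
have fs' : free (in_tuple s) := fs.
move/freeP: fs' => /(_ (fun i => m s`_i)) H; apply: (H _ (Ordinal i_s)).
by rewrite -[RHS]E [RHS](big_nth 0) big_mkord.
Qed.

Let int_coef_eta a : int_span simple_eta a -> exists2 m : hdual h -> int,
  a = \sum_(b <- rs_simple D) b *~ m b &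
  forall b, b \notin simple_eta -> m b = 0.
Proof.
move=> [m ->]; exists (fun b => if b \in simple_eta then m b else 0).
  rewrite /simple_eta big_filter big_mkcond /=; apply: eq_big_seq => b bs.
  by rewrite mem_filter bs andbT; case: ifP => //; rewrite mulr0z.
by move=> b /negPf ->.
Qed.

Let roots_etaP a : a \in roots_eta <-> is_root a /\ int_span simple_eta a.
Proof.
rewrite mem_filter; split => [/andP[/asboolP ? /rs_rootsP]|[/rs_rootsP ? ?]] //.
by apply/andP; split => //; apply/asboolP.
Qed.

Let nil_rootsP a : a \in nil_roots <->
  [/\ is_root a, nat_span (rs_simple D) a & ~ int_span simple_eta a].
Proof.
rewrite !mem_filter; split.
  case/and3P=> /negP aN /asboolP ap ar; have /rs_rootsP ? := ar; split => //.
  by move=> ia; apply: aN; apply/andP; split => //; apply/asboolP.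
case=> /rs_rootsP -> an ai; rewrite !andbT; apply/andP; split; last exact/asboolP.
by apply/negP => /asboolP.
Qed.

Lemma int_spanD (s : seq (hdual h)) a b :
  int_span s a -> int_span s b -> int_span s (a + b).
Proof.
move=> [m ->] [n ->]; exists (fun c => m c + n c); rewrite -big_split /=.
by apply: eq_bigr => c _; rewrite mulrzDr.
Qed.

Lemma int_spanN (s : seq (hdual h)) a : int_span s a -> int_span s (- a).
Proof.
move=> [m ->]; exists (fun c => - m c); rewrite -sumrN.
by apply: eq_bigr => c _; rewrite mulrNz.
Qed.

Lemma nat_spanD (s : seq (hdual h)) a b :
  nat_span s a -> nat_span s b -> nat_span s (a + b).
Proof.
move=> [m ->] [n ->]; exists (fun c => m c + n c)%N; rewrite -big_split /=.
by apply: eq_bigr => c _; rewrite mulrnDr.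
Qed.

(* A natural combination whose sum with another one lies in the span of
   [simple_eta] lies in this span. *)
Let nat_face a b : nat_span (rs_simple D) a -> nat_span (rs_simple D) b ->
  int_span simple_eta (a + b) -> int_span simple_eta a.
Proof.
move=> [m Ea] [n Eb] /int_coef_eta[k Ek k0].
have H c : c \in rs_simple D -> (m c + n c)%:R = (k c)%:~R :> F.
  move=> cs; apply/eqP; rewrite -subr_eq0; apply/eqP; move: c cs.
  apply: (free_coef (rs_simple_free D)).
  under eq_bigr do rewrite scalerBl scaler_nat scaler_int mulrnDr.
  by rewrite sumrB big_split /= -Ea -Eb -Ek subrr.
exists (fun c => (m c)%:Z); rewrite Ea /simple_eta big_filter [RHS]big_mkcond /=.
apply: eq_big_seq => c cs; case: ifPn => // cN.
have : (m c + n c)%:R = 0 :> F.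
  rewrite H // k0 ?mulr0z // mem_filter cs andbT; exact: cN.
by move/eqP; rewrite pnatr_eq0 addn_eq0 => /andP[/eqP -> _]; rewrite mulr0n.
Qed.

Let nil_root_add a b : is_root (a + b) ->
  int_span simple_eta a -> b \in nil_roots -> a + b \in nil_roots.
Proof.
move=> r ai /nil_rootsP[br bn bi].
have abi : ~ int_span simple_eta (a + b).
  by move=> /int_spanD/(_ (int_spanN ai)); rewrite addrAC subrr add0r.
apply/nil_rootsP; split => //.
case: (rs_signed (iffRL (rs_rootsP _) r)) => // nab.
case: bi; apply: (nat_face bn nab).
by rewrite opprD addrCA subrr addr0; exact: int_spanN.
Qed.

Let nil_root_add2 a b : is_root (a + b) ->
  a \in nil_roots -> b \in nil_roots -> a + b \in nil_roots.
Proof.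
move=> r /nil_rootsP[ar an ai] /nil_rootsP[br bn bi].
apply/nil_rootsP; split => //; first exact: nat_spanD.
by move/(nat_face an bn).
Qed.

Let lie_h a x y : x \in rs_h D -> y \in g_ a -> lie x y \in g_ a.
Proof. by move=> xh ya; have /rootspaceP/(_ (Subvs xh)) /= -> := ya; exact: memvZ. Qed.

Let sub_h_levi x : x \in rs_h D -> x \in levi_space.
Proof. by move=> xh; rewrite -[x]addr0 memv_add ?mem0v. Qed.

Let sub_root_levi a x : a \in roots_eta -> x \in g_ a -> x \in levi_space.
Proof. by move=> ar xa; rewrite -[x]add0r memv_add ?mem0v // (memv_sum_seq ar). Qed.

Fact levi_closed : lie_closed levi_space.
Proof.
have half x y : x \in levi_space ->
    (forall x', x' \in rs_h D -> lie x' y \in levi_space) ->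
    (forall a x', a \in roots_eta -> x' \in g_ a -> lie x' y \in levi_space) ->
    lie x y \in levi_space.
  move=> /memv_addP[x0 x0h [x1 x1s ->]] H1 H2; rewrite lieDl memvD ?(H1 _ x0h) //.
  exact: lie_sum_sub H2 x1s.
move=> x y xl yl; apply: (half _ _ xl) => [x' x'h|a x' ar x'a];
  rewrite lieC memvN; apply: (half _ _ yl) => [y' y'h|b y' br y'b].
- by apply: sub_h_levi; exact: subLieP.
- by rewrite lieC memvN; apply: sub_root_levi br _; exact: lie_h.
- by apply: sub_root_levi ar _; exact: lie_h.
- have /roots_etaP[_ ai] := ar; have /roots_etaP[_ bi] := br.
  case: (rootspace_cases (rs_cartan D) (lie_rootspace y'b x'a)).
  + by move=> ->; rewrite mem0v.
  + by case=> _; exact: sub_h_levi.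
  + move=> r; apply: (@sub_root_levi (b + a)); last exact: lie_rootspace.
    by apply/roots_etaP; split => //; exact: int_spanD.
Qed.

Let nil_bracket a b x y : is_root (a + b) -> a + b \in nil_roots ->
  x \in g_ a -> y \in g_ b -> lie x y \in nilrad_eta.
Proof.
move=> r ab xa yb; rewrite nilrad_etaE; apply: (memv_sum_seq ab).
exact: lie_rootspace.
Qed.

Lemma levi_nilrad x y :
  x \in levi_space -> y \in nilrad_eta -> lie x y \in nilrad_eta.
Proof.
move=> /memv_addP[x0 x0h [x1 x1s ->]]; rewrite nilrad_etaE => yn.
rewrite -nilrad_etaE lieC memvN; apply: lie_sum_sub yn => b y' br y'b.
rewrite lieC memvN lieDl memvD //.
  by rewrite nilrad_etaE (memv_sum_seq br) // lie_h.
apply: lie_sum_sub x1s => a x' ar x'a; have /roots_etaP[_ ai] := ar.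
case: (rootspace_cases (rs_cartan D) (lie_rootspace x'a y'b)).
- by move=> ->; rewrite mem0v.
- case=> ab0 _; have /nil_rootsP[_ _ []] := br.
  suff -> : b = - a by exact: int_spanN.
  by apply/eqP; rewrite -addr_eq0 addrC ab0.
- by move=> r; apply: nil_bracket x'a y'b => //; exact: nil_root_add.
Qed.

Lemma nilrad_levi x y :
  x \in nilrad_eta -> y \in levi_space -> lie x y \in nilrad_eta.
Proof. by move=> xn yl; rewrite lieC memvN levi_nilrad. Qed.

Lemma nilrad_nilrad x y :
  x \in nilrad_eta -> y \in nilrad_eta -> lie x y \in nilrad_eta.
Proof.
rewrite {1 2}nilrad_etaE => xn yn.
apply: lie_sum_sub xn => a x' ar x'a.
rewrite lieC memvN; apply: lie_sum_sub yn => b y' br y'b; rewrite lieC memvN.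
case: (rootspace_cases (rs_cartan D) (lie_rootspace x'a y'b)).
- by move=> ->; rewrite mem0v.
- case=> ab0 _; have /nil_rootsP[_ an []] := ar; have /nil_rootsP[_ bn _] := br.
  apply: (nat_face an bn); rewrite ab0; exists (fun=> 0).
  by rewrite big1 // => c _; rewrite mulr0z.
- by move=> r; apply: nil_bracket x'a y'b => //; exact: nil_root_add2.
Qed.

Fact parabolic_closed : lie_closed parabolic_space.
Proof.
move=> _ _ /memv_addP[x0 x0l [x1 x1n ->]] /memv_addP[y0 y0l [y1 y1n ->]].
rewrite lieDl !lieDr -addrA memv_add ?levi_closed //.
apply: memvD; first exact: levi_nilrad.
by apply: memvD; [exact: nilrad_levi | exact: nilrad_nilrad].
Qed.

Lemma levi_nilrad_disjoint : (levi_space :&: nilrad_eta = 0)%VS.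
Proof.
rewrite nilrad_etaE; apply: disjoint_root_sums; first exact: rs_cartan.
  rewrite cat_uniq /nil_roots /pos_roots !filter_uniq ?rs_roots_uniq //= andbT.
  by apply/hasPn => a; rewrite mem_filter => /andP[].
apply/negP; rewrite mem_cat => /orP[/roots_etaP[[]]|/nil_rootsP[[]]];
  by rewrite eqxx.
Qed.

Definition levi : subLie L := SubLie levi_closed.
Definition parabolic : subLie L := SubLie parabolic_closed.

Definition levi_proj_fun (x : subLie_of parabolic) : subLie_of levi :=
  vsproj levi (daddv_pi levi nilrad_eta (sub_val x)).

Fact levi_proj_linear : linear levi_proj_fun.
Proof. by move=> a x y; rewrite /levi_proj_fun !linearP. Qed.
HB.instance Definition _ := GRing.isLinear.Build F (subLie_of parabolic)
  (subLie_of levi) _ levi_proj_fun levi_proj_linear.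

Lemma levi_projE (x : subLie_of parabolic) y z :
  y \in levi_space -> z \in nilrad_eta -> sub_val x = y + z ->
  sub_val (levi_proj_fun x) = y.
Proof.
move=> yl zn; rewrite /levi_proj_fun => E.
rewrite [sub_val (vsproj _ _)]vsprojK ?memv_pi // E raddfD /=.
have dj := levi_nilrad_disjoint.
rewrite daddv_pi_id //.
have zs : z \in (levi_space + nilrad_eta)%VS by rewrite -[z]add0r memv_add ?mem0v.
have := daddv_pi_add dj zs; rewrite [X in _ + X]daddv_pi_id 1?capvC //.
by move/(canRL (addrK z)); rewrite subrr => ->; rewrite addr0.
Qed.

Fact levi_proj_lie x y :
  levi_proj_fun (lie x y) = lie (levi_proj_fun x) (levi_proj_fun y).
Proof.
apply: val_inj.
have /memv_addP[x0 x0l [x1 x1n Ex]] := sub_valP x.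
have /memv_addP[y0 y0l [y1 y1n Ey]] := sub_valP y.
rewrite [RHS]sub_val_lie.
rewrite (levi_projE x0l x1n Ex) (levi_projE y0l y1n Ey).
apply: (@levi_projE _ _ (lie x0 y1 + (lie x1 y0 + lie x1 y1))).
- exact: levi_closed.
- apply: memvD; first exact: levi_nilrad.
by apply: memvD; [exact: nilrad_levi | exact: nilrad_nilrad].
- by rewrite sub_val_lie Ex Ey lieDl !lieDr -!addrA.
Qed.

Definition levi_proj : lieHom (subLie_of parabolic) (subLie_of levi) :=
  @LieHom F _ _ levi_proj_fun levi_proj_lie.

(* [V] as a module over the parabolic: [levi_proj] kills [nilrad_eta], which
   therefore acts by zero. *)
Definition inflate (V : lmodType (Uea (subLie_of levi))) :
    lmodType (Uea (subLie_of parabolic)) :=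
  resmod V (uea_map levi_proj).

Definition Ind (V : lmodType (Uea (subLie_of levi))) : lmodType (Uea L) :=
  extmod (uea_map (sub_incl parabolic)) (inflate V).

End Parabolic.

Definition chevalley_vector (F : numFieldType) (L : lieAlgType F)
    (D : rootSetup L) (x y : hdual (rs_h D) -> L) (a : hdual (rs_h D)) : L :=
  if a \in pos_roots D then x a else y (- a).

(* Only the values of [cb_x], [cb_y], [cb_h] at positive roots matter.  The last
   field is the condition N(-a, -b) = - N(a, b) on the structure constants; it
   is what makes [transpose] below consistent with the bracket. *)
Record chevalleyBasis (F : numFieldType) (L : lieAlgType F) (D : rootSetup L) :=
  ChevalleyBasis {
  cb_x : hdual (rs_h D) -> L;
  cb_y : hdual (rs_h D) -> L;
  cb_h : hdual (rs_h D) -> subLie_of (rs_h D);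
  cb_xP : forall a, a \in pos_roots D -> cb_x a \in rootspace a;
  cb_yP : forall a, a \in pos_roots D -> cb_y a \in rootspace (- a);
  cb_xy : forall a, a \in pos_roots D -> lie (cb_x a) (cb_y a) = sub_val (cb_h a);
  cb_coroot : forall a, a \in pos_roots D -> a (cb_h a) = 2;
  cb_basis : basis_of fullv
    ([seq cb_x a | a <- pos_roots D] ++ [seq cb_y a | a <- pos_roots D] ++
     [seq sub_val (cb_h a) | a <- rs_simple D]);
  cb_constants : forall a b c,
    a \in rs_roots D -> b \in rs_roots D -> a + b \in rs_roots D ->
    let e := chevalley_vector cb_x cb_y in
    lie (e a) (e b) = c *: e (a + b) ->
    lie (e (- a)) (e (- b)) = - c *: e (- (a + b))
}.

Definition transpose (F : numFieldType) (L : lieAlgType F) (D : rootSetup L)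
    (B : chevalleyBasis D) (tau : Uea L -> Uea L) :=
  antiautomorphism tau /\
  forall a, a \in pos_roots D ->
    [/\ tau (uea_in (cb_x B a)) = uea_in (cb_y B a),
        tau (uea_in (cb_y B a)) = uea_in (cb_x B a) &
        tau (uea_in (sub_val (cb_h B a))) = uea_in (sub_val (cb_h B a))].

(* Main.v *)
(** A contravariant form on [Ind V] is determined by its restriction to
  [1 (x) V]: this subspace generates [Ind V] under the opposite nilradical, whose
  transpose, the nilradical, kills it.  Conversely a form [f] on [V] extends by
  [(u (x) v, m) |-> f v (pi (tau u m))], where [pi : Ind V -> V] is the projection
  that kills the opposite nilradical times [Ind V]; symmetry of the extension
  follows from uniqueness, because [tau] is an involution.

  Instead of the Poincare-Birkhoff-Witt theorem, [pi] rests on the fact that, if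
  [L] is the direct sum of two subalgebras [A] and [B], the right multiplication
  of [A] on [U(A)] extends to an action of [L] in which [B] kills [1]. *)
From HB Require Import structures.
Require Import Defs.
From mathcomp Require Import all_boot all_order all_algebra.
From mathcomp Require Import reals complex.
From mathcomp Require Import boolp functions.

Set Implicit Arguments.
Unset Strict Implicit.
Unset Printing Implicit Defensive.

Import Order.TTheory GRing.Theory Num.Theory.
Local Open Scope ring_scope.

(** * Right actions of a Lie algebra and their extension to its enveloping algebra *)

Record right_action (F : fieldType) (L : lieAlgType F) (W : lmodType F) :=
  RightAction {
  raction :> L -> W -> W;
  raction_linear : forall x, linear (raction x);
  raction_linearl : forall w, linear (raction^~ w);
  raction_lie : forall x y w,
    raction (lie x y) w = raction y (raction x w) - raction x (raction y w)
}.

Section RightActionLift.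
Variables (F : fieldType) (L : lieAlgType F) (W : lmodType F).
Variable act : right_action L W.

(** Reading [act x w] as [w . x], the field [raction_lie] is [w . [x, y] = (w . x) . y - (w . y) .
    x], so a product acts by its left factor first. Acting with formal expressions avoids forming
    the opposite of an endomorphism algebra of [W]. *)
Fixpoint term_ract (s : uterm L) (w : W) : W :=
  match s with
  | UGen x => act x w
  | UZero => 0
  | UOne => w
  | UOpp s => - term_ract s w
  | UAdd s t => term_ract s w + term_ract t w
  | UMul s t => term_ract t (term_ract s w)
  | UScale a s => a *: term_ract s w
  end.

Lemma term_ract_linear s : linear (term_ract s).
Proof.
elim: s => [x|||s IHs|s IHs t IHt|s IHs t IHt|b s IHs] a v w //=.
- exact: raction_linear.
- by rewrite scaler0 addr0.
- by rewrite IHs opprD scalerN.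
- by rewrite IHs IHt scalerDr addrACA.
- by rewrite IHs IHt.
- by rewrite IHs scalerDr !scalerA mulrC.
Qed.

Lemma term_ractD s v w : term_ract s (v + w) = term_ract s v + term_ract s w.
Proof. by have := term_ract_linear s 1 v w; rewrite !scale1r. Qed.

Lemma term_ractZ s a w : term_ract s (a *: w) = a *: term_ract s w.
Proof.
have E0 : term_ract s 0 = 0.
  by apply: (addrI (term_ract s 0)); rewrite -term_ractD !addr0.
by have := term_ract_linear s a w 0; rewrite !addr0 E0 addr0.
Qed.

Lemma term_ract_ueq s t : ueq s t -> term_ract s =1 term_ract t.
Proof.
elim=> /= [s'|s' t' _ IH|s' t' u _ IH1 _ IH2|s' t' _ IH|s' t' u v _ IH1 _ IH2
  |s' t' u v _ IH1 _ IH2|a s' t' _ IH|s' t' u|s' t'|s'|s'|s' t' u|s'|s'|s' t' u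
  |s' t' u|a b s'|s'|a s' t'|a b s'|a s' t'|a s' t'|a x y|x y] w //=.
- by rewrite IH1.
- by rewrite IH.
- by rewrite IH1 IH2.
- by rewrite IH1 IH2.
- by rewrite IH.
- by rewrite addrA.
- by rewrite addrC.
- by rewrite add0r.
- by rewrite addNr.
- exact: term_ractD.
- by rewrite scalerA.
- by rewrite scale1r.
- by rewrite scalerDr.
- by rewrite scalerDl.
- by rewrite term_ractZ.
- exact: raction_linearl.
- exact: raction_lie.
Qed.

Definition ract (u : Uea L) : W -> W := term_ract (urep u).

Lemma ract_class s : ract (uclass s) =1 term_ract s.
Proof. exact/term_ract_ueq/urep_class. Qed.

Lemma ract_in x w : ract (uea_in x) w = act x w.
Proof. exact: ract_class. Qed.

Lemma ract1 w : ract 1 w = w.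
Proof. exact: ract_class. Qed.

Lemma ractM u v w : ract (u * v) w = ract v (ract u w).
Proof.
elim/uclassW: u => s; elim/uclassW: v => t.
by rewrite -uclassM !ract_class.
Qed.

Lemma ract_linear u : linear (ract u).
Proof. exact: term_ract_linear. Qed.

Lemma ract_linearl w : linear (ract^~ w).
Proof.
move=> a; elim/uclassW=> s; elim/uclassW=> t.
by rewrite -uclassZ -uclassD !ract_class.
Qed.

HB.instance Definition _ u := GRing.isLinear.Build F W W _ (ract u) (ract_linear u).

Lemma ractDl u v w : ract (u + v) w = ract u w + ract v w.
Proof. by have := ract_linearl w 1 u v; rewrite !scale1r. Qed.

Lemma ractZl a u w : ract (a *: u) w = a *: ract u w.
Proof.
have E0 : ract 0 w = 0 by apply: (addrI (ract 0 w)); rewrite -ractDl !addr0.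
by have := ract_linearl w a u 0; rewrite !addr0 E0 addr0.
Qed.

End RightActionLift.

(** * Induction on elements of the enveloping algebra *)

Section UeaInd.
Variables (F : fieldType) (L : lieAlgType F) (P : Uea L -> Prop).
Hypothesis PD : forall u v, P u -> P v -> P (u + v).
Hypothesis PZ : forall a u, P u -> P (a *: u).
Hypothesis P1 : P 1.

Lemma uea_ind_right : (forall u x, P u -> P (u * uea_in x)) -> forall u, P u.
Proof.
(* Generalising 1 to any [v] satisfying [P] turns the claim into: right multiplication by [u]
   preserves [P]. The product case is then a composition. *)
move=> PM u; rewrite -[u]mul1r; move: 1 P1 => v.
elim/uclassW: u v; elim=> [x|||s IH|s IHs t IHt|s IHs t IHt|a s IH] v Pv.
- exact: PM.
- by rewrite uclass0 mulr0 -(scale0r v); exact: PZ.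
- by rewrite uclass1 mulr1.
- by rewrite uclassN mulrN -scaleN1r; apply/PZ/IH.
- by rewrite uclassD mulrDr; apply: PD; [exact: IHs | exact: IHt].
- by rewrite uclassM mulrA; apply/IHt/IHs.
- by rewrite uclassZ -scalerAr; apply/PZ/IH.
Qed.

Lemma uea_ind_left : (forall x u, P u -> P (uea_in x * u)) -> forall u, P u.
Proof.
move=> PM u; rewrite -[u]mulr1; move: 1 P1 => v.
elim/uclassW: u v; elim=> [x|||s IH|s IHs t IHt|s IHs t IHt|a s IH] v Pv.
- exact: PM.
- by rewrite uclass0 mul0r -(scale0r v); exact: PZ.
- by rewrite uclass1 mul1r.
- by rewrite uclassN mulNr -scaleN1r; apply/PZ/IH.
- by rewrite uclassD mulrDl; apply: PD; [exact: IHs | exact: IHt].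
- by rewrite uclassM -mulrA; apply/IHs/IHt.
- by rewrite uclassZ -scalerAl; apply/PZ/IH.
Qed.
End UeaInd.

(** * The vector space of linear maps *)

Section LinearMaps.
Variables (F : fieldType) (V W : lmodType F).

Definition is_linear_map : {pred V -> W} := [pred f | `[< linear f >]].

Fact is_linear_map_submod : submod_closed is_linear_map.
Proof.
split; first by apply/asboolP => a x y; rewrite /0%R /= scaler0 addr0.
move=> c f g /asboolP fl /asboolP gl; apply/asboolP => a x y.
have E z : (c *: f + g) z = c *: f z + g z by [].
by rewrite !E fl gl !scalerDr addrACA !scalerA mulrC.
Qed.
HB.instance Definition _ := GRing.isSubmodClosed.Build F (V -> W)
  is_linear_map is_linear_map_submod.

(** The target will be an enveloping algebra, in general of infinite dimension, so the maps form a
    subspace of all functions instead of a ['Hom'] between finite-dimensional spaces. *)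
Record linear_map := LinearMap {
  linear_map_fun :> V -> W;
  linear_mapP : linear_map_fun \in is_linear_map
}.
HB.instance Definition _ := [isSub for linear_map_fun].
HB.instance Definition _ := [Choice of linear_map by <:].
HB.instance Definition _ := [SubChoice_isSubLmodule of linear_map by <:].

Definition mk_linear_map (f : V -> W) (fl : linear f) : linear_map :=
  LinearMap (introT (asboolP _) fl).

Lemma linear_map_linear (f : linear_map) : linear f.
Proof. exact/asboolP/linear_mapP. Qed.

Lemma linear_map_eq (f g : linear_map) : f =1 g -> f = g.
Proof. by move=> fg; apply/val_inj/funext. Qed.

HB.instance Definition _ (f : linear_map) :=
  GRing.isLinear.Build F V W _ f (linear_map_linear f).
End LinearMaps.

(** * The complement action and the projection of [U(L)] onto [U(A)] *)

(* Extends the right multiplication action of [A] on [U(A)] to [L]: as a right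
   [L]-module, [U(A)] is induced from the trivial module of a subalgebra [B]
   complementary to [A], given here as the kernel of the projection [pA]. *)
Section ComplementAction.
Variables (F : fieldType) (L : lieAlgType F) (A : subLie L).
Variable pA : {linear L -> subLie_of A}.
Hypothesis pAK : forall a, pA (sub_val a) = a.
Hypothesis pA_ker : forall x y, pA x = 0 -> pA y = 0 -> pA (lie x y) = 0.

Local Notation UA := (Uea (subLie_of A)).
Local Notation ops := (linear_map L UA).

(* The operator [x |-> (w . x)] attached to [w : U(A)] is determined by
   [1 . x = pA x] and [(w a) . x = (w . x) a + w . [a, x]]. *)
Definition op_act_fun (a : subLie_of A) (f : ops) (x : L) : UA :=
  f x * uea_in a + f (lie (sub_val a) x).

Fact op_act_subproof a f : linear (op_act_fun a f).
Proof.
move=> b x y; rewrite /op_act_fun !linearP /= mulrDl scalerDr -scalerAl.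
by rewrite addrACA.
Qed.

Definition op_act a f : ops := mk_linear_map (op_act_subproof a f).

Lemma op_actE a f x : op_act a f x = f x * uea_in a + f (lie (sub_val a) x).
Proof. by []. Qed.

Fact op_act_linear a : linear (op_act a).
Proof.
move=> b f g; apply: linear_map_eq => x.
have E (f' g' : ops) z : (b *: f' + g') z = b *: f' z + g' z by [].
rewrite !E /= /op_act_fun !E mulrDl scalerDr -scalerAl.
by rewrite addrACA.
Qed.

Fact op_act_linearl f : linear (op_act^~ f).
Proof.
move=> b a a'; apply: linear_map_eq => x.
have E (f' g' : ops) z : (b *: f' + g') z = b *: f' z + g' z by [].
rewrite !E /= /op_act_fun !linearP /= lieDl lieZl !linearP /= mulrDr scalerDr.
by rewrite -scalerAr addrACA.
Qed.

(** The mixed terms [f [a, x] * a'] and [f [a', x] * a] occur in both composites and cancel; the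
    rest is the bracket relation in [U(A)] and the Jacobi identity. *)
Fact op_act_lie a a' f :
  op_act (lie a a') f = op_act a' (op_act a f) - op_act a (op_act a' f).
Proof.
apply: linear_map_eq => x.
have E (f' g' : ops) z : (f' - g') z = f' z - g' z by [].
rewrite E !op_actE uea_in_lie sub_val_lie.
have -> : lie (lie (sub_val a) (sub_val a')) x =
    lie (sub_val a) (lie (sub_val a') x) - lie (sub_val a') (lie (sub_val a) x).
  by rewrite lie_leibniz addrK.
rewrite raddfB mulrBr !mulrDl !mulrA /=.
set r := f (lie (sub_val a) x) * _; set s := f (lie (sub_val a') x) * _.
rewrite !opprD !addrA [RHS](ACl ((1*5)*(4*8)*((2*7)*(3*6)))) /=.
by rewrite !subrr !addr0 addrA.
Qed.

Definition op_action : right_action (subLie_of A) ops :=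
  RightAction op_act_linear op_act_linearl op_act_lie.

Fact proj_op_subproof : linear (fun x : L => uea_in (pA x)).
Proof. by move=> b x y; rewrite !linearP. Qed.

Definition proj_op : ops := mk_linear_map proj_op_subproof.

(** The element [w . x]: the operator attached to 1 is transported by [w] and evaluated at [x]. It
    is well defined in [w] because [op_action] is a Lie action, with no basis of [U(A)] chosen. *)
Definition comp_act (x : L) (w : UA) : UA := ract op_action w proj_op x.

Lemma comp_act_linear x : linear (comp_act x).
Proof.
move=> b v w; rewrite /comp_act ract_linearl.
by [].
Qed.

Lemma comp_act_linearl w : linear (comp_act^~ w).
Proof. by move=> b x y; exact: linear_map_linear. Qed.

Lemma comp_act1 x : comp_act x 1 = uea_in (pA x).
Proof. by rewrite /comp_act ract1. Qed.

Lemma comp_actM x w a :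
  comp_act x (w * uea_in a) = comp_act x w * uea_in a + comp_act (lie (sub_val a) x) w.
Proof.
rewrite /comp_act ractM.
by rewrite ract_in.
Qed.

HB.instance Definition _ x :=
  GRing.isLinear.Build F UA UA _ (comp_act x) (comp_act_linear x).

Lemma comp_actDl x y w : comp_act (x + y) w = comp_act x w + comp_act y w.
Proof. by have := comp_act_linearl w 1 x y; rewrite !scale1r. Qed.

(** On [A] the recursion reproduces right multiplication: [(w a') . a = w a a' + w [a', a] = w a'
    a]. *)
Lemma comp_act_sub a w : comp_act (sub_val a) w = w * uea_in a.
Proof.
elim/uea_ind_right: w a => [u v IHu IHv|b u IH||u a' IH] a.
- by rewrite raddfD /= IHu IHv mulrDl.
- by rewrite linearZ /= IH scalerAl.
- by rewrite comp_act1 pAK mul1r.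
rewrite comp_actM IH -(sub_val_lie a' a) IH uea_in_lie mulrBr !mulrA addrC.
by rewrite subrK.
Qed.

(** This is where the kernel of [pA] being a subalgebra enters: splitting [x] and [y] along [pA],
    the bracket of the two kernel parts is killed. The identity is the case [w = 1] of
    [comp_act_lie]. *)
Lemma pA_lie x y :
  pA (lie x y) =
  lie (pA y) (pA x) + (pA (lie (sub_val (pA x)) y) - pA (lie (sub_val (pA y)) x)).
Proof.
have [x1 [Ex x1K]] : exists x1, x = sub_val (pA x) + x1 /\ pA x1 = 0.
  by exists (x - sub_val (pA x)); rewrite addrC subrK raddfB /= pAK subrr.
have [y1 [Ey y1K]] : exists y1, y = sub_val (pA y) + y1 /\ pA y1 = 0.
  by exists (y - sub_val (pA y)); rewrite addrC subrK raddfB /= pAK subrr.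
move: (pA x) (pA y) Ex Ey => a b -> ->.
have pAL c d : pA (lie (sub_val c) (sub_val d)) = lie c d by rewrite -sub_val_lie pAK.
rewrite !lieDl !lieDr !(raddfD pA) /= !pAL (pA_ker x1K y1K) addr0.
rewrite (lieC x1 (sub_val b)) raddfN /= opprD.
by rewrite !addrA [RHS](ACl ((2*3*5)*(1*4))) /= subrr addr0.
Qed.

(** Induction on [w], for all [x] and [y]. For [w a] the Leibniz rule splits [[a, [x, y]]], and the
    hypothesis is applied to the pairs [x, y], then [[a, x], y], then [x, [a, y]]. *)
Lemma comp_act_lie x y w :
  comp_act (lie x y) w = comp_act y (comp_act x w) - comp_act x (comp_act y w).
Proof.
elim/uea_ind_right: w x y => [u v IHu IHv|b u IH||u a IH] x y.
- by rewrite !raddfD /= IHu IHv addrACA.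
- by rewrite !linearZ /= IH scalerBr scalerN.
- have E x' y' : comp_act y' (uea_in (pA x')) =
      uea_in (pA y') * uea_in (pA x') + uea_in (pA (lie (sub_val (pA x')) y')).
    by rewrite -[X in comp_act _ X]mul1r comp_actM !comp_act1.
  by rewrite !comp_act1 !E pA_lie !raddfD raddfN /= uea_in_lie addrACA.
rewrite !comp_actM lie_leibniz comp_actDl (IH x y) (IH (lie _ x) y).
rewrite (IH x (lie _ y)) !raddfD /= !comp_actM mulrBl !addrA.
by rewrite ?opprD !addrA [RHS](ACl (1*4*3*5*2*6)).
Qed.

Definition comp_action : right_action L UA :=
  RightAction comp_act_linear comp_act_linearl comp_act_lie.

(** The image of 1 under [u]. It is right [U(A)]-linear ([comp_projMr]) and kills [ker pA] times
    [U(L)] ([comp_proj_ker]), so it is the projection that the Poincare-Birkhoff-Witt decomposition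
    would give. *)
Definition comp_proj (u : Uea L) : UA := ract comp_action u 1.

Let incl := uea_map (sub_incl A).

Lemma comp_proj_linear : linear comp_proj.
Proof. by move=> b u v; rewrite /comp_proj ract_linearl. Qed.

Lemma comp_act_uea u w : ract comp_action (incl u) w = w * u.
Proof.
elim/uea_ind_right: u w => [u v IHu IHv|b u IH||u a IH] w.
- by rewrite raddfD /= !ractDl IHu IHv mulrDr.
- by rewrite ?linearZ /= !ractZl IH scalerAr.
- by rewrite rmorph1 ract1 mulr1.
by rewrite (rmorphM incl) ractM IH /= uea_liftE ract_in /= comp_act_sub mulrA.
Qed.

Lemma comp_projMr u v : comp_proj (u * incl v) = comp_proj u * v.
Proof.
by rewrite /comp_proj ractM comp_act_uea.
Qed.

Lemma comp_proj_ker x u : pA x = 0 -> comp_proj (uea_in x * u) = 0.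
Proof.
move=> xK; rewrite /comp_proj ractM.
rewrite ract_in /= comp_act1 xK.
by rewrite !raddf0.
Qed.

Lemma comp_proj1 : comp_proj 1 = 1.
Proof. by rewrite /comp_proj ract1. Qed.

(** * Left linearity over elements normalizing the complement *)

Section Normalizer.
Variable a : subLie_of A.
Hypothesis aK : forall x, pA x = 0 -> pA (lie (sub_val a) x) = 0.

(** The case [w = 1] is the crux: since [a] normalizes the kernel, [pA [a, x] = [a, pA x]], hence
    [pA x * a + [a, pA x] = a * pA x]. The recursion, made of right multiplications, carries this to
    every [w]. *)
Lemma comp_act_mull x w : comp_act x (uea_in a * w) = uea_in a * comp_act x w.
Proof.
elim/uea_ind_right: w x => [u v IHu IHv|b u IH||u a' IH] x.
- by rewrite mulrDr !raddfD /= IHu IHv mulrDr.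
- by rewrite -scalerAr !linearZ /= IH scalerAr.
- rewrite mulr1 -[uea_in a]mul1r comp_actM !comp_act1 !mul1r.
  have /aK : pA (x - sub_val (pA x)) = 0 by rewrite raddfB /= pAK subrr.
  rewrite !raddfB /= => /eqP; rewrite subr_eq0 => /eqP ->.
  by rewrite -sub_val_lie pAK uea_in_lie addrC subrK.
by rewrite mulrA !comp_actM !IH mulrDr mulrA.
Qed.

Lemma comp_projMl u : comp_proj (uea_in (sub_val a) * u) = uea_in a * comp_proj u.
Proof.
rewrite /comp_proj ractM.
rewrite ract_in /= comp_act_sub mul1r.
(* With 1 generalised to [w], the claim is that the action of [u] commutes with left multiplication
   by [a]. *)
rewrite -[uea_in a in LHS]mulr1; move: 1 => w.
elim/uea_ind_right: u w => [u v IHu IHv|b u IH||u x IH] w.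
- by rewrite !ractDl IHu IHv mulrDr.
- by rewrite !ractZl IH scalerAr.
- by rewrite !ract1.
rewrite !ractM IH.
by rewrite !ract_in /= comp_act_mull.
Qed.
End Normalizer.
End ComplementAction.

(** * Induction on tensors and the universal property *)

Section TensorLift.
Variables (A B : nzRingType) (phi : {rmorphism A -> B}) (V : lmodType A).
Local Notation tensor := (tensor phi (V := V)).

(** Closure under sums also covers 0 and opposites, because [- (b (x) v) = (- b) (x) v]. *)
Lemma tensor_ind (P : extmod phi V -> Prop) :
  (forall x y, P x -> P y -> P (x + y)) -> (forall b v, P (tensor b v)) ->
  forall x, P x.
Proof.
move=> PD Pt x.
have tN b v : - tensor b v = tensor (- b) v.
  have t0 : tensor 0 v = 0 by apply: (addrI (tensor 0 v)); rewrite -tensorDl !addr0.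
  by apply/eqP; rewrite eq_sym -addr_eq0 -tensorDl addNr t0.
(* Carrying [P (- x)] along handles formal opposites. *)
suff [] : P x /\ P (- x) by [].
elim/tclassW: x; elim=> [b v||s [Ps PNs]|s [Ps PNs] t [Pt' PNt]].
- by split; rewrite ?[- _]tN; exact: Pt.
- by rewrite tclass0 oppr0; split; rewrite -(addNr (tensor 0 0)) tN; apply: PD.
- by rewrite tclassN opprK.
- by rewrite tclassD opprD; split; apply: PD.
Qed.

Variables (M : zmodType) (h : B -> V -> M).
Hypothesis hDl : forall b c v, h (b + c) v = h b v + h c v.
Hypothesis hDr : forall b v w, h b (v + w) = h b v + h b w.
Hypothesis h_balanced : forall b a v, h (b * phi a) v = h b (a *: v).

Fixpoint teval (s : tterm B V) : M :=
  match s with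
  | TPure b v => h b v
  | TZero => 0
  | TOpp s => - teval s
  | TAdd s t => teval s + teval t
  end.

Lemma teval_teq s t : teq phi s t -> teval s = teval t.
Proof.
elim=> //= [s' t' u _ -> _ -> //|s' t' _ ->//|s' s'' t' t'' _ -> _ -> //|s' t' u|s' t'|s'|s'].
- by rewrite addrA.
- by rewrite addrC.
- by rewrite add0r.
- by rewrite addNr.
Qed.

Definition tensor_lift (x : extmod phi V) : M := teval (trep x).

Lemma tensor_lift_class s : tensor_lift (tclass phi s) = teval s.
Proof. exact/teval_teq/trep_class. Qed.

Lemma tensor_liftE b v : tensor_lift (tensor b v) = h b v.
Proof. exact: tensor_lift_class. Qed.

Lemma tensor_liftD x y : tensor_lift (x + y) = tensor_lift x + tensor_lift y.
Proof.
elim/tclassW: x => s; elim/tclassW: y => t.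
by rewrite -tclassD !tensor_lift_class.
Qed.
End TensorLift.

(** * The opposite nilradical and the triangular decomposition *)

Section OppositeNilradical.
Variables (F : numFieldType) (L : lieAlgType F) (D : rootSetup L).
Variable eta : 'Hom(subLie_of (borel_nil D), F^o).

Local Notation g_ := (@rootspace F L (rs_h D)).
Local Notation simple := (rs_simple D).
Local Notation simple_e := (simple_eta eta).
Local Notation roots_e := (roots_eta eta).

(** By freeness of the simple roots, the coefficients outside [simple_e] satisfy [m c + n c = 0] in
    characteristic 0; being natural numbers, both vanish. *)
Lemma nat_span_face a b : nat_span simple a -> nat_span simple b ->
  int_span simple_e (a + b) -> int_span simple_e a.
Proof.
move=> [m Ea] [n Eb] [k Ek]; exists (fun c => (m c)%:Z).
pose k' c := if c \in simple_e then k c else 0.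
have {}Ek : a + b = \sum_(c <- simple) c *~ k' c.
  rewrite Ek /simple_eta big_filter big_mkcond; apply: eq_big_seq => c cs.
  by rewrite /k' mem_filter cs andbT; case: ifP => // _; rewrite mulr0z.
have coef0 c : c \in simple -> (m c + n c)%:R - (k' c)%:~R = 0 :> F.
  apply: (free_coef (m := fun c => (m c + n c)%:R - (k' c)%:~R) (rs_simple_free D)).
  under eq_bigr do rewrite scalerBl scaler_nat scaler_int mulrnDr.
  by rewrite sumrB big_split /= -Ea -Eb -Ek subrr.
rewrite Ea /simple_eta big_filter [RHS]big_mkcond; apply: eq_big_seq => c cs.
case: ifPn => // cN; have := coef0 c cs.
rewrite /k' mem_filter (negPf cN) /= subr0 => /eqP.
by rewrite pnatr_eq0 addn_eq0 => /andP[/eqP -> _]; rewrite mulr0n.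
Qed.

Lemma roots_etaP a : a \in roots_e <-> a \in rs_roots D /\ int_span simple_e a.
Proof.
by rewrite mem_filter; split => [/andP[/asboolP]|[-> /asboolP ->]].
Qed.

Definition opp_nil_roots :=
  [seq a <- rs_roots D | `[< nat_span simple (- a) >] & a \notin roots_e].

Definition opp_nilrad : {vspace L} := (\sum_(a <- opp_nil_roots) g_ a)%VS.

Lemma opp_nil_rootsP a : a \in opp_nil_roots <->
  [/\ is_root a, nat_span simple (- a) & ~ int_span simple_e a].
Proof.
rewrite mem_filter; split.
  case/andP=> /andP[/asboolP na /negP aN] ar.
  by split => //; [exact/rs_rootsP | move=> ai; apply: aN; exact/roots_etaP].
case=> /rs_rootsP ar na ai; rewrite ar andbT; apply/andP; split.
  exact/asboolP.
by apply/negP => /roots_etaP[].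
Qed.

Lemma opp_nilrad_closed : lie_closed opp_nilrad.
Proof.
move=> x y xn yn; apply: lie_sum_sub xn => a x' ar x'a.
rewrite lieC memvN; apply: lie_sum_sub yn => b y' br y'b; rewrite lieC memvN.
have /opp_nil_rootsP[_ an ai] := ar; have /opp_nil_rootsP[_ bn _] := br.
have not_eta : ~ int_span simple_e (a + b).
  move/int_spanN; rewrite opprD => /(nat_span_face an bn)/int_spanN.
  by rewrite opprK.
case: (rootspace_cases (rs_cartan D) (lie_rootspace x'a y'b)).
- by move=> ->; rewrite mem0v.
- case=> ab0; case: not_eta; rewrite ab0; exists (fun=> 0).
  by rewrite big1 // => c _; rewrite mulr0z.
- move=> r; apply: (memv_sum_seq (i := a + b)); last exact: lie_rootspace.
  by apply/opp_nil_rootsP; split; rewrite ?opprD //; exact: nat_spanD.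
Qed.

Lemma levi_opp_nilrad x y :
  x \in levi_space eta -> y \in opp_nilrad -> lie x y \in opp_nilrad.
Proof.
move=> /memv_addP[x0 x0h [x1 x1s ->]] yn.
rewrite lieC memvN; apply: lie_sum_sub yn => b y' br y'b.
rewrite lieC memvN lieDl memvD //.
  apply: (memv_sum_seq br).
  by have /rootspaceP/(_ (Subvs x0h)) /= -> := y'b; exact: memvZ.
apply: lie_sum_sub x1s => a x' ar x'a; have /roots_etaP[_ ai] := ar.
have /opp_nil_rootsP[_ bn bi] := br.
have not_eta : ~ int_span simple_e (a + b).
  by move=> /int_spanD/(_ (int_spanN ai)); rewrite addrAC subrr add0r.
case: (rootspace_cases (rs_cartan D) (lie_rootspace x'a y'b)).
- by move=> ->; rewrite mem0v.
- case=> ab0; case: not_eta; rewrite ab0; exists (fun=> 0).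
  by rewrite big1 // => c _; rewrite mulr0z.
- move=> r; apply: (memv_sum_seq (i := a + b)); last exact: lie_rootspace.
  apply/opp_nil_rootsP; split => //.
  (* If [a + b] were positive, then [- b] and [a + b] would be natural combinations with sum [a] in
     the span of [simple_e], which would force [b] into that span. *)
  case: (rs_signed (iffRL (rs_rootsP _) r)) => // nab; case: bi.
  rewrite -[b]opprK; apply/int_spanN/(nat_span_face bn nab).
  by rewrite addrC addrK.
Qed.

Lemma parabolic_opp_nilrad_disjoint : (parabolic_space eta :&: opp_nilrad = 0)%VS.
Proof.
rewrite /parabolic_space /levi_space /nilrad_eta -[X in (_ + _ + X)%VS]big_filter.
rewrite -addvA -big_cat /=.
have uniq_roots := rs_roots_uniq D.
apply: disjoint_root_sums; first exact: rs_cartan.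
  rewrite !cat_uniq !filter_uniq //= !andbT; apply/andP; split.
    by apply/hasPn => a; rewrite mem_filter => /andP[].
  apply/hasPn => a /opp_nil_rootsP[ar na ai].
  rewrite mem_cat; apply/norP; split; apply/negP; first by case/roots_etaP.
  rewrite !mem_filter => /and3P[_ /asboolP ap _]; case: ai.
  apply: (nat_span_face ap na); rewrite subrr; exists (fun=> 0).
  by rewrite big1 // => c _; rewrite mulr0z.
by apply/negP; rewrite !mem_cat !mem_filter => /orP[/orP[]|] /andP[_]; rewrite ?mem_filter;
  try case/andP => _; case/rs_rootsP; rewrite eqxx.
Qed.

Variable B : chevalleyBasis D.

Definition nil_roots := [seq a <- pos_roots D | a \notin roots_e].

Lemma cb_basis_not0 : 0 \notin ([seq cb_x B a | a <- pos_roots D] ++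
  [seq cb_y B a | a <- pos_roots D] ++ [seq sub_val (cb_h B a) | a <- simple]).
Proof.
by apply/negP => /(free_not0 (basis_free (cb_basis B))); rewrite eqxx.
Qed.

(** The vector [cb_y B a] belongs to a basis, so it is a nonzero vector of weight [- a]. *)
Lemma opp_pos_root a : a \in pos_roots D -> - a \in rs_roots D.
Proof.
move=> ap; apply/rs_rootsP; split.
  rewrite oppr_eq0; move: ap; rewrite mem_filter => /andP[_ /rs_rootsP[]]//.
apply/eqP => E; have := cb_yP B ap; rewrite E memv0 => /eqP y0.
have := cb_basis_not0; rewrite -y0 !mem_cat; case/negP; apply/orP; right.
by apply/orP; left; exact: map_f.
Qed.

Lemma opp_nil_root a : a \in nil_roots -> - a \in opp_nil_roots.
Proof.
rewrite mem_filter => /andP[/negP ai ap]; apply/opp_nil_rootsP; split.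
- exact/rs_rootsP/opp_pos_root.
- by rewrite opprK; move: ap; rewrite mem_filter => /andP[/asboolP].
- move/int_spanN; rewrite opprK => ai'; apply: ai; apply/roots_etaP; split => //.
  by move: ap; rewrite mem_filter => /andP[].
Qed.

Local Notation Xn := <<[seq cb_x B a | a <- nil_roots]>>%VS.
Local Notation Yn := <<[seq cb_y B a | a <- nil_roots]>>%VS.

Lemma span_cb_x_nilrad : (Xn <= nilrad_eta eta)%VS.
Proof.
apply/span_subvP => _ /mapP[a an ->]; rewrite /nilrad_eta -big_filter.
apply: (memv_sum_seq an); apply: cb_xP.
by move: an; rewrite mem_filter => /andP[].
Qed.

Lemma span_cb_y_opp_nilrad : (Yn <= opp_nilrad)%VS.
Proof.
apply/span_subvP => _ /mapP[a an ->]; apply: (memv_sum_seq (opp_nil_root an)).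
by apply: cb_yP; move: an; rewrite mem_filter => /andP[].
Qed.

Lemma triangular_full : (fullv <= Xn + levi_space eta + Yn)%VS.
Proof.
rewrite -(span_basis (cb_basis B)); apply/span_subvP => x.
have sX : (Xn <= Xn + levi_space eta + Yn)%VS by rewrite -addvA addvSl.
have sL : (levi_space eta <= Xn + levi_space eta + Yn)%VS.
  by rewrite [(Xn + _)%VS]addvC -addvA addvSl.
have sY : (Yn <= Xn + levi_space eta + Yn)%VS by rewrite addvSr.
have root_levi a y : a \in roots_e -> y \in g_ a -> y \in levi_space eta.
  move=> ar ya; apply/(subvP (addvSr _ _)); exact: (memv_sum_seq ar).
rewrite !mem_cat => /or3P[] /mapP[a ap ->].
- have [ar|ar] := boolP (a \in roots_e).
    by apply/(subvP sL)/(root_levi a) => //; exact: cb_xP.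
  by apply/(subvP sX)/memv_span/map_f; rewrite mem_filter ar.
- have [ar|ar] := boolP (a \in roots_e).
    apply/(subvP sL)/(root_levi (- a)); last exact: cb_yP.
    apply/roots_etaP; split; first exact: opp_pos_root.
    by apply: int_spanN; have /roots_etaP[] := ar.
  by apply/(subvP sY)/memv_span/map_f; rewrite mem_filter ar.
- by apply/(subvP sL)/(subvP (addvSl _ _)); exact: sub_valP.
Qed.

Lemma parabolic_opp_nilrad_full : (parabolic_space eta + opp_nilrad = fullv)%VS.
Proof.
apply/eqP; rewrite eqEsubv subvf; apply: subv_trans triangular_full _.
by rewrite addvS ?span_cb_y_opp_nilrad // addvC addvS ?span_cb_x_nilrad.
Qed.

(** Both [Xn] and the nilradical are independent of the Levi part and the opposite nilradical, and
    [Xn] already suffices to fill [L]. Hence [tau], prescribed on Chevalley vectors, is known on the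
    whole nilradical. *)
Lemma nilrad_etaE : nilrad_eta eta = Xn.
Proof.
apply/eqP; rewrite eqEsubv span_cb_x_nilrad andbT; apply/subvP => z zn.
have /memv_addP[_ /memv_addP[x xX [l ll ->]] [y yY E]] := subvP triangular_full z (memvf z).
have xn := subvP span_cb_x_nilrad x xX; have yn := subvP span_cb_y_opp_nilrad y yY.
have y0 : y = 0.
  apply/eqP; rewrite -memv0 -parabolic_opp_nilrad_disjoint memv_cap yn andbT.
  rewrite -[y](addKr (x + l)) -E addrC memvB //; first exact: (subvP (addvSr _ _)).
  by rewrite /parabolic_space addvC memv_add.
have l0 : l = 0.
  apply/eqP; rewrite -memv0 -(levi_nilrad_disjoint eta) memv_cap ll /=.
  by rewrite -[l](addKr x) addrC memvB // -[x + l]addr0 -y0 -E.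
by rewrite E y0 l0 !addr0.
Qed.

Lemma opp_nilradE : opp_nilrad = Yn.
Proof.
apply/eqP; rewrite eqEsubv span_cb_y_opp_nilrad andbT; apply/subvP => z zn.
have /memv_addP[w /memv_addP[x xX [l ll Ew]] [y yY E]] := subvP triangular_full z (memvf z).
have yn := subvP span_cb_y_opp_nilrad y yY.
suff w0 : w = 0 by rewrite E w0 add0r.
apply/eqP; rewrite -memv0 -parabolic_opp_nilrad_disjoint memv_cap Ew.
rewrite {1}/parabolic_space addvC memv_add ?(subvP span_cb_x_nilrad) //= -Ew.
by rewrite -[w](addrK y) -E memvB.
Qed.

End OppositeNilradical.

(** * The transpose: an involution exchanging the two nilradicals *)

Lemma uea_span_ind (F : fieldType) (L : lieAlgType F) (P : Uea L -> Prop) (X : seq L) x :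
  P 0 -> (forall u v, P u -> P v -> P (u + v)) -> (forall a u, P u -> P (a *: u)) ->
  (forall e, e \in X -> P (uea_in e)) -> x \in <<X>>%VS -> P (uea_in x).
Proof.
move=> P0 PD PZ PX xX; rewrite (coord_span (X := in_tuple X) xX) raddf_sum /=.
elim/big_rec: _ => // i u _ Pu; apply: PD => //; rewrite linearZ; apply: PZ.
by apply: PX; rewrite mem_nth.
Qed.

Section Transpose.
Variables (F : numFieldType) (L : lieAlgType F) (D : rootSetup L).
Variables (B : chevalleyBasis D) (tau : Uea L -> Uea L).
Hypothesis tauP : transpose B tau.
Variable eta : 'Hom(subLie_of (borel_nil D), F^o).

Lemma tau_linear : linear tau. Proof. by case: tauP => -[]. Qed.
HB.instance Definition _ := GRing.isLinear.Build F (Uea L) (Uea L) _ tau tau_linear.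

Lemma tauD u v : tau (u + v) = tau u + tau v. Proof. exact: raddfD. Qed.
Lemma tauZ a u : tau (a *: u) = a *: tau u. Proof. exact: linearZ. Qed.
Lemma tau1 : tau 1 = 1. Proof. by case: tauP => -[]. Qed.
Lemma tauM u v : tau (u * v) = tau v * tau u. Proof. by case: tauP => -[]. Qed.

(** The square of [tau] preserves products and fixes every vector of the Chevalley basis. *)
Lemma tauK u : tau (tau u) = u.
Proof.
elim/uea_ind_left: u => [u v IHu IHv|b u IH||x u IH].
- by rewrite !raddfD /= IHu IHv.
- by rewrite !linearZ /= IH.
- by rewrite !tau1.
rewrite !tauM IH; congr (_ * _).
have := memvf x; rewrite -(span_basis (cb_basis B)).
apply: (uea_span_ind (P := fun u => tau (tau u) = u)) => [|v w Ev Ew|b v Ev|e].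
- by rewrite !raddf0.
- by rewrite !raddfD /= Ev Ew.
- by rewrite !linearZ /= Ev.
have [_ tauB] := tauP.
rewrite !mem_cat => /or3P[] /mapP[a ap ->].
- by have [-> -> _] := tauB a ap.
- by have [Ex -> _] := tauB a ap.
(* The values of [tau] are prescribed at positive roots; a simple root is one, its coefficients
   being the indicator of [a]. *)
have ap' : a \in pos_roots D.
  rewrite mem_filter (rs_simple_sub ap) andbT; apply/asboolP.
  exists (fun b => (b == a) : nat).
  rewrite (bigD1_seq a ap) /=; last exact: free_uniq (rs_simple_free D).
  by rewrite eqxx big1 ?addr0 // => b /negPf ->.
by have [_ _ E] := tauB a ap'; rewrite !E.
Qed.

Definition uea_image (U : {vspace L}) (u : Uea L) := exists2 y, y \in U & u = uea_in y.

Lemma tau_span (X : seq L) (U : {vspace L}) x :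
  (forall e, e \in X -> uea_image U (tau (uea_in e))) -> x \in <<X>>%VS ->
  uea_image U (tau (uea_in x)).
Proof.
apply: (uea_span_ind (P := fun u => uea_image U (tau u))).
- by exists 0; rewrite ?mem0v // !raddf0.
- move=> u v [y yU Ey] [z zU Ez]; exists (y + z); first exact: memvD.
  by rewrite !raddfD /= Ey Ez.
- move=> a u [y yU Ey]; exists (a *: y); first exact: memvZ.
  by rewrite !linearZ /= Ey.
Qed.

Lemma tau_nilrad x : x \in nilrad_eta eta -> uea_image (opp_nilrad eta) (tau (uea_in x)).
Proof.
rewrite (nilrad_etaE eta B); apply: tau_span => _ /mapP[a an ->].
have ap : a \in pos_roots D by move: an; rewrite mem_filter => /andP[].
have [_ /(_ a ap)[-> _ _]] := tauP; exists (cb_y B a) => //.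
by apply/(subvP (span_cb_y_opp_nilrad eta B))/memv_span/map_f.
Qed.

Lemma tau_opp_nilrad x : x \in opp_nilrad eta -> uea_image (nilrad_eta eta) (tau (uea_in x)).
Proof.
rewrite (opp_nilradE eta B); apply: tau_span => _ /mapP[a an ->].
have ap : a \in pos_roots D by move: an; rewrite mem_filter => /andP[].
have [_ /(_ a ap)[_ -> _]] := tauP; exists (cb_x B a) => //.
by apply/(subvP (span_cb_x_nilrad eta B))/memv_span/map_f.
Qed.

End Transpose.

(** * The Harish-Chandra projection and the projection of [Ind V] onto [V] *)

Section InducedProjection.
Variables (F : numFieldType) (L : lieAlgType F) (D : rootSetup L).
Variables (B : chevalleyBasis D).
Variable eta : 'Hom(subLie_of (borel_nil D), F^o).
Variable V : lmodType (Uea (subLie_of (levi eta))).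

Local Notation p := (parabolic eta).
Local Notation l := (levi eta).
Local Notation incl := (uea_map (sub_incl l)).
Local Notation inclp := (uea_map (sub_incl p)).

Definition par_proj (x : L) : subLie_of p := vsproj p (daddv_pi p (opp_nilrad eta) x).

Fact par_proj_linear : linear par_proj.
Proof. by move=> a x y; rewrite /par_proj !linearP. Qed.
HB.instance Definition _ := GRing.isLinear.Build F L (subLie_of p) _ par_proj par_proj_linear.

Lemma par_projK a : par_proj (sub_val a) = a.
Proof.
apply: val_inj; rewrite [LHS]vsprojK ?memv_pi // daddv_pi_id ?sub_valP //.
exact: parabolic_opp_nilrad_disjoint.
Qed.

Lemma par_proj_eq0 x : (par_proj x == 0) = (x \in opp_nilrad eta).
Proof.
have dj := parabolic_opp_nilrad_disjoint eta.
have dj' : (opp_nilrad eta :&: p = 0)%VS by rewrite capvC.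
have full : x \in (p + opp_nilrad eta)%VS by rewrite (parabolic_opp_nilrad_full eta B) memvf.
have E : sub_val (par_proj x) + daddv_pi (opp_nilrad eta) p x = x.
  by rewrite [sub_val _]vsprojK ?memv_pi // daddv_pi_add.
apply/eqP/idP => [x0|xn].
  by rewrite -E x0 raddf0 add0r memv_pi.
apply: val_inj; move: E; rewrite (daddv_pi_id dj' xn).
by move/(canRL (addrK _)); rewrite subrr.
Qed.

Lemma par_proj_ker x y : par_proj x = 0 -> par_proj y = 0 -> par_proj (lie x y) = 0.
Proof.
move=> /eqP x0 /eqP y0; apply/eqP; move: x0 y0; rewrite !par_proj_eq0.
exact: opp_nilrad_closed.
Qed.

Lemma levi_sub_parabolic x : x \in l -> x \in p.
Proof. by move=> xl; apply/(subvP (addvSl _ _)). Qed.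

Definition levi_par (x : subLie_of l) : subLie_of p := Subvs (levi_sub_parabolic (sub_valP x)).

Lemma levi_par_proj x : levi_proj eta (levi_par x) = x.
Proof.
apply: val_inj; apply: (@levi_projE _ _ _ _ _ _ 0); rewrite ?mem0v ?addr0 //.
exact: sub_valP.
Qed.

Lemma nilrad_sub_parabolic x : x \in nilrad_eta eta -> x \in p.
Proof. by move=> xl; apply/(subvP (addvSr _ _)). Qed.

(* The Harish-Chandra projection along [opp_nilrad U(L) + U(L) nilrad]. *)
Definition hc_proj (u : Uea L) : Uea (subLie_of l) :=
  uea_map (levi_proj eta) (comp_proj par_projK par_proj_ker u).

Fact hc_proj_linear : linear hc_proj.
Proof. by move=> a u v; rewrite /hc_proj comp_proj_linear linearP. Qed.
HB.instance Definition _ := GRing.isLinear.Build F (Uea L) (Uea (subLie_of l)) _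
  hc_proj hc_proj_linear.

Lemma hc_proj1 : hc_proj 1 = 1.
Proof. by rewrite /hc_proj comp_proj1 rmorph1. Qed.

Lemma hc_projMr u v : hc_proj (u * inclp v) = hc_proj u * uea_map (levi_proj eta) v.
Proof. by rewrite /hc_proj comp_projMr rmorphM. Qed.

Lemma hc_proj_opp y u : y \in opp_nilrad eta -> hc_proj (uea_in y * u) = 0.
Proof.
rewrite -par_proj_eq0 => /eqP y0.
by rewrite /hc_proj comp_proj_ker // raddf0.
Qed.

(** The Levi normalizes the opposite nilradical, which is the kernel of [par_proj], so [comp_projMl]
    applies. *)
Lemma hc_projMl x u : hc_proj (uea_in (sub_val x) * u) = uea_in x * hc_proj u.
Proof.
rewrite /hc_proj -[sub_val x]/(sub_val (levi_par x)).
rewrite comp_projMl.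
  by rewrite rmorphM [X in X * _]uea_map_in levi_par_proj.
move=> y /eqP y0; apply/eqP; move: y0; rewrite !par_proj_eq0.
by apply: levi_opp_nilrad; exact: (sub_valP x).
Qed.

Definition ind_proj (m : Ind V) : V :=
  tensor_lift (V := inflate V) (fun u v => hc_proj u *: (v : V)) m.

Lemma ind_projE u (v : V) : ind_proj (tensor inclp (u : Uea L) (v : inflate V)) = hc_proj u *: v.
Proof.
apply: tensor_liftE => [b c w|b w z|b a w].
- by rewrite raddfD scalerDl.
- by rewrite scalerDr.
- by rewrite hc_projMr -scalerA.
Qed.

Lemma ind_projD x y : ind_proj (x + y) = ind_proj x + ind_proj y.
Proof.
apply: tensor_liftD => [b c w|b w z|b a w].
- by rewrite raddfD scalerDl.
- by rewrite scalerDr.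
- by rewrite hc_projMr -scalerA.
Qed.

Lemma ind_proj_opp y m : y \in opp_nilrad eta -> ind_proj (uea_in y *: m) = 0.
Proof.
move=> yn; elim/tensor_ind: m => [m1 m2 E1 E2|u v].
  by rewrite scalerDr ind_projD E1 E2 addr0.
by rewrite tensorZ ind_projE hc_proj_opp // scale0r.
Qed.

Lemma ind_projZ u m : ind_proj (incl u *: m) = u *: ind_proj m.
Proof.
elim/tensor_ind: m => [m1 m2 E1 E2|w v].
  by rewrite scalerDr !ind_projD E1 E2 scalerDr.
rewrite tensorZ !ind_projE scalerA; congr (_ *: _).
elim/uea_ind_left: u => [u1 u2 E1 E2|b u E||x u E].
- by rewrite raddfD mulrDl raddfD /= E1 E2 mulrDl.
- by rewrite linearZ /= -!scalerAl linearZ /= E.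
- by rewrite rmorph1 !mul1r.
- rewrite rmorphM /= uea_liftE -!mulrA.
  by rewrite hc_projMl E.
Qed.

Lemma parabolic_tensor (x : subLie_of p) (v : V) :
  uea_in (sub_val x) *: tensor inclp 1 (v : inflate V) =
  tensor inclp 1 (uea_in (levi_proj eta x) *: v : inflate V).
Proof.
rewrite tensorZ mulr1 -[uea_in (sub_val x)](uea_map_in (sub_incl p)).
rewrite -[X in tensor _ X _]mul1r tensor_balanced; congr (tensor _ _ _).
exact: (congr1 (fun u => u *: v) (uea_map_in (levi_proj eta) x)).
Qed.

Lemma nilrad_tensor x (v : V) : x \in nilrad_eta eta ->
  uea_in x *: tensor inclp 1 (v : inflate V) = 0.
Proof.
move=> xn; have := parabolic_tensor (Subvs (nilrad_sub_parabolic xn)) v.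
rewrite /sub_val /= => ->.
have -> : levi_proj eta (Subvs (nilrad_sub_parabolic xn)) = 0.
  by apply: val_inj; apply: (@levi_projE _ _ _ _ _ _ x); rewrite ?mem0v ?add0r.
rewrite raddf0 scale0r; apply: (addrI (tensor inclp 1 (0 : inflate V))).
by rewrite -tensorDr !addr0.
Qed.

(** The subspace [U(opp_nilrad) (1 (x) V)], described by generation so that a claim on [Ind V] can
    be checked on [1 (x) V] and on elements [y m] with [y] in the opposite nilradical. *)
Inductive opp_spanned : Ind V -> Prop :=
| opp_spanned_base (v : V) : opp_spanned (tensor inclp 1 (v : inflate V))
| opp_spannedD x y : opp_spanned x -> opp_spanned y -> opp_spanned (x + y)
| opp_spannedM y m : y \in opp_nilrad eta -> opp_spanned m -> opp_spanned (uea_in y *: m).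

(** Induction on [m] for all [x] at once: [x y m = y x m + [x, y] m], and the hypothesis covers both
    [x] and [[x, y]]. On [1 (x) V], the parabolic part of [x] acts inside [1 (x) V]. *)
Lemma opp_spanned_stable m : opp_spanned m -> forall x, opp_spanned (uea_in x *: m).
Proof.
elim=> {m} [v|m1 m2 _ IH1 _ IH2|y m yn mS IH] x.
- have : x \in (p + opp_nilrad eta)%VS by rewrite (parabolic_opp_nilrad_full eta B) memvf.
  case/memv_addP=> x1 x1p [y yn ->]; rewrite raddfD scalerDl; apply: opp_spannedD.
    rewrite -[x1]/(sub_val (Subvs x1p)) parabolic_tensor; exact: opp_spanned_base.
  by apply: opp_spannedM yn _; exact: opp_spanned_base.
- by rewrite scalerDr; apply: opp_spannedD.
- have -> : uea_in x *: (uea_in y *: m) = uea_in y *: (uea_in x *: m) + uea_in (lie x y) *: m.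
    by rewrite uea_in_lie scalerBl !scalerA addrC subrK.
  by apply: opp_spannedD; [apply: opp_spannedM | exact: IH].
Qed.

Lemma opp_spannedZ a m : opp_spanned m -> opp_spanned ((a%:A : Uea L) *: m).
Proof.
elim=> {m} [v|m1 m2 _ IH1 _ IH2|y m yn mS IH].
- rewrite tensorZ mulr1 -(rmorph_alg inclp) -[X in tensor _ X _]mul1r tensor_balanced.
  exact: opp_spanned_base.
- by rewrite scalerDr; apply: opp_spannedD.
- rewrite scalerA -scalerAl mul1r -[uea_in y]mulr1 scalerAr -scalerA.
  exact: opp_spannedM.
Qed.

Lemma opp_spanned_all m : opp_spanned m.
Proof.
elim/tensor_ind: m => [x y|u v]; first exact: opp_spannedD.
rewrite -[u]mulr1 -tensorZ.
elim/uea_ind_left: u => [u1 u2|a u||x u] .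
- by rewrite scalerDl; exact: opp_spannedD.
- by move=> uS; rewrite -[u]mul1r scalerAl -scalerA; exact: opp_spannedZ.
- by rewrite scale1r; exact: opp_spanned_base.
- by move=> uS; rewrite -scalerA; exact: opp_spanned_stable.
Qed.

End InducedProjection.

(** * Elementary rules for contravariant forms *)

Section ContraFormTheory.
Variables (F : fieldType) (A : algType F) (t : A -> A) (X : lmodType A).
Variable f : contraForm t X.

Lemma contra_formP : is_contravariant t f.
Proof. exact/asboolP/contra_funP. Qed.

Lemma contra_formDl x y z : f (x + y) z = f x z + f y z.
Proof. by case: contra_formP => /(_ z 1 x y); rewrite !scale1r mul1r. Qed.

Lemma contra_formDr x y z : f x (y + z) = f x y + f x z.
Proof. by case: contra_formP => _ /(_ x 1 y z); rewrite !scale1r mul1r. Qed.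

Lemma contra_form0r x : f x 0 = 0.
Proof. by apply: (addrI (f x 0)); rewrite -contra_formDr !addr0. Qed.

Lemma contra_formZr a x y : f x (a%:A *: y) = a * f x y.
Proof.
case: contra_formP => _ /(_ x a y 0).
by rewrite addr0 contra_form0r addr0.
Qed.

Lemma contra_formZl a x y : f (a%:A *: x) y = a * f x y.
Proof. by case: contra_formP => _ _ C _; rewrite C contra_formZr C. Qed.

Lemma contra_form_tau u x y : f (u *: x) y = f x (t u *: y).
Proof. by case: contra_formP. Qed.

Lemma contraForm_eq (g : contraForm t X) : (forall x y, f x y = g x y) -> f = g.
Proof. by move=> E; apply: val_inj; apply/funext => x; apply/funext => y; exact: E. Qed.

End ContraFormTheory.

(** * Contravariant forms on the induced module *)

Section InducedForms.
Variables (F : numFieldType) (L : lieAlgType F) (D : rootSetup L).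
Variables (B : chevalleyBasis D) (tau : Uea L -> Uea L).
Hypothesis tauP : transpose B tau.
Variable eta : 'Hom(subLie_of (borel_nil D), F^o).

Local Notation p := (parabolic eta).
Local Notation l := (levi eta).
Local Notation incl := (uea_map (sub_incl l)).
Local Notation inclp := (uea_map (sub_incl p)).

Variable tau_l : Uea (subLie_of l) -> Uea (subLie_of l).
Hypothesis tau_lP : forall u, incl (tau_l u) = tau (incl u).
Variable V : lmodType (Uea (subLie_of l)).

Local Notation one_tensor v := (tensor inclp 1 (v : inflate V) : Ind V).

(** For [y] in the opposite nilradical, [G (1 (x) v) (y m) = G (tau y (1 (x) v)) m = 0], as [tau y]
    lies in the nilradical. Stated for biadditive [G], it serves both for the difference of two
    forms and for the antisymmetrization of [ext_form]. *)
Lemma ind_form_eq0 (G : Ind V -> Ind V -> F) :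
  (forall x y z, G (x + y) z = G x z + G y z) ->
  (forall x y z, G x (y + z) = G x y + G x z) ->
  (forall u x y, G (u *: x) y = G x (tau u *: y)) ->
  (forall v w, G (one_tensor v) (one_tensor w) = 0) ->
  forall x y, G x y = 0.
Proof.
move=> GDl GDr Gtau G0 x.
have G00 y : G 0 y = 0 by apply: (addrI (G 0 y)); rewrite -GDl !addr0.
have G1 v y : G (one_tensor v) y = 0.
  elim: (opp_spanned_all B y) => {y} [w|y z _ Ey _ Ez|y m yn _ _] //.
    by rewrite GDr Ey Ez addr0.
  have [z zn Ez] := tau_opp_nilrad tauP yn.
  by rewrite -[uea_in y](tauK tauP) -Gtau Ez nilrad_tensor.
elim/tensor_ind: x => [x1 x2 E1 E2|u v] y; first by rewrite GDl E1 E2 addr0.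
by rewrite -[u]mulr1 -tensorZ Gtau G1.
Qed.

(** * Extending a form from [V] to [Ind V] *)

Section Extension.
Variable f : contraForm tau_l V.

(** This makes [ext_form] balanced over the parabolic. Split [x] into [x0] in the Levi and [x1] in
    the nilradical: [ind_proj] kills [tau x1] times anything, and for [x0] it is Levi-linear while
    [f] is contravariant. *)
Lemma form_parabolic u (v : V) m :
  f v (ind_proj B (tau (inclp u) *: m)) = f (uea_map (levi_proj eta) u *: v) (ind_proj B m).
Proof.
elim/uea_ind_left: u v m => [u1 u2 E1 E2|a u E||x u E] v m.
- by rewrite raddfD (tauD tauP) scalerDl ind_projD contra_formDr E1 E2
    -contra_formDl -scalerDl -raddfD.
- have -> : inclp (a *: u) = a *: inclp u by exact: linearZ.
  have -> : uea_map (levi_proj eta) (a *: u) = a *: uea_map (levi_proj eta) u.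
    exact: linearZ.
  rewrite (tauZ tauP) -[tau _ in LHS]mul1r scalerAl -scalerA.
  rewrite -(rmorph_alg incl) ind_projZ contra_formZr E.
  by rewrite -[uea_map _ u in RHS]mul1r scalerAl -scalerA contra_formZl.
- by rewrite !rmorph1 (tau1 tauP) !scale1r.
have -> : inclp (uea_in x * u) = inclp (uea_in x) * inclp u by exact: rmorphM.
have -> : uea_map (levi_proj eta) (uea_in x * u) =
    uea_map (levi_proj eta) (uea_in x) * uea_map (levi_proj eta) u by exact: rmorphM.
rewrite (tauM tauP) -scalerA E -scalerA.
move: (uea_map _ u *: v) => {E}w.
have /memv_addP[x0 x0l [x1 x1n Ex]] := sub_valP x.
have Ei : inclp (uea_in x) = uea_in x0 + uea_in x1.
  by rewrite -raddfD -[_ + _]Ex; exact: uea_map_in.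
pose x0' : subLie_of l := Subvs x0l.
have El : uea_map (levi_proj eta) (uea_in x) = uea_in x0'.
  rewrite [LHS]uea_map_in; congr uea_in; apply: val_inj.
  exact: (levi_projE x0l x1n Ex).
have Ex0 : incl (uea_in x0') = uea_in x0 by exact: uea_map_in.
have [y yn Ey] := tau_nilrad tauP x1n.
rewrite Ei El (tauD tauP) scalerDl ind_projD contra_formDr Ey ind_proj_opp //.
rewrite contra_form0r addr0 -Ex0 -tau_lP ind_projZ.
by rewrite contra_form_tau.
Qed.

Definition ext_form (x y : Ind V) : F^o :=
  tensor_lift (V := inflate V) (M := F)
    (fun u v => f v (ind_proj B (tau u *: y))) x.

Let tensor_hyps y :
  [/\ forall b c (v : V), f v (ind_proj B (tau (b + c) *: y)) =
        f v (ind_proj B (tau b *: y)) + f v (ind_proj B (tau c *: y)),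
      forall b (v w : V), f (v + w) (ind_proj B (tau b *: y)) =
        f v (ind_proj B (tau b *: y)) + f w (ind_proj B (tau b *: y)) &
      forall b a (v : inflate V), f v (ind_proj B (tau (b * inclp a) *: y)) =
        f (a *: v) (ind_proj B (tau b *: y))].
Proof.
split=> [b c v|b v w|b a v].
- by rewrite (tauD tauP) scalerDl ind_projD contra_formDr.
- exact: contra_formDl.
- by rewrite (tauM tauP) -scalerA form_parabolic.
Qed.

Lemma ext_formE u (v : V) y :
  ext_form (tensor inclp u (v : inflate V)) y = f v (ind_proj B (tau u *: y)).
Proof. by have [H1 H2 H3] := tensor_hyps y; exact: tensor_liftE. Qed.

Lemma ext_formDl x y z : ext_form (x + y) z = ext_form x z + ext_form y z.
Proof. by have [H1 H2 H3] := tensor_hyps z; exact: tensor_liftD. Qed.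

Lemma ext_formDr x y z : ext_form x (y + z) = ext_form x y + ext_form x z.
Proof.
elim/tensor_ind: x => [x1 x2 E1 E2|u v].
  by rewrite !ext_formDl E1 E2 addrACA.
by rewrite !ext_formE scalerDr ind_projD contra_formDr.
Qed.

Lemma ext_form_tau u x y : ext_form (u *: x) y = ext_form x (tau u *: y).
Proof.
elim/tensor_ind: x => [x1 x2 E1 E2|w v].
  by rewrite scalerDr !ext_formDl E1 E2.
by rewrite tensorZ !ext_formE (tauM tauP) scalerA.
Qed.

Lemma ext_form_scaler a x y : ext_form x (a%:A *: y) = a * ext_form x y.
Proof.
elim/tensor_ind: x => [x1 x2 E1 E2|w v].
  by rewrite !ext_formDl E1 E2 mulrDr.
rewrite !ext_formE scalerA -scalerAr mulr1 -[_ w in LHS]mul1r scalerAl -scalerA.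
by rewrite -(rmorph_alg incl) ind_projZ contra_formZr.
Qed.

Lemma ext_form1 v w : ext_form (one_tensor v) (one_tensor w) = f v w.
Proof.
by rewrite ext_formE (tau1 tauP) scale1r ind_projE hc_proj1 scale1r.
Qed.

Lemma ext_form_sym x y : ext_form x y = ext_form y x.
Proof.
apply/eqP; rewrite -subr_eq0; apply/eqP; move: x y.
apply: (@ind_form_eq0 (fun x y => ext_form x y - ext_form y x)).
- by move=> x y z; rewrite ext_formDl ext_formDr opprD addrACA.
- by move=> x y z; rewrite ext_formDl ext_formDr opprD addrACA.
(* The flipped form is contravariant as well, since [tau (tau u) = u]. *)
- by move=> u x y; rewrite !ext_form_tau (tauK tauP).
- move=> v w; rewrite !ext_form1.
  by case: (contra_formP f) => _ _ -> _; rewrite subrr.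
Qed.

Lemma ext_form_contravariant : is_contravariant tau ext_form.
Proof.
split.
- by move=> w a u v; rewrite ext_formDl ext_form_sym ext_form_scaler ext_form_sym.
- by move=> u a v w; rewrite ext_formDr ext_form_scaler.
- by move=> v w; exact: ext_form_sym.
- exact: ext_form_tau.
Qed.

Definition ext_contra : contraForm tau (Ind V) :=
  ContraForm (introT (asboolP _) ext_form_contravariant).

End Extension.

(** * Restricting a form from [Ind V] to [1 (x) V] *)

Section Restriction.
Variable G : contraForm tau (Ind V).

Definition res_form (v w : V) : F^o := G (one_tensor v) (one_tensor w).

Lemma one_tensorD v w : one_tensor (v + w) = one_tensor v + one_tensor w.
Proof. exact: tensorDr. Qed.

Lemma one_tensor_alg a (v : V) : one_tensor (a%:A *: v) = a%:A *: one_tensor v.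
Proof.
rewrite [RHS]tensorZ mulr1 -(rmorph_alg inclp) -[X in _ = tensor _ X _]mul1r.
rewrite tensor_balanced; congr (tensor _ _ _).
by rewrite -[RHS]/(uea_map (levi_proj eta) a%:A *: v) rmorph_alg.
Qed.

Lemma one_tensorZ u (v : V) : one_tensor (u *: v) = incl u *: one_tensor v.
Proof.
elim/uea_ind_left: u v => [u1 u2 E1 E2|a u E||x u E] v.
- by rewrite raddfD !scalerDl one_tensorD E1 E2.
- have -> : incl (a *: u) = a *: incl u by exact: linearZ.
  rewrite -[u]mul1r scalerAl -scalerA mul1r -[incl u]mul1r scalerAl -scalerA -E.
  exact: one_tensor_alg.
- by rewrite rmorph1 !scale1r.
- have -> : incl (uea_in x * u) = uea_in (sub_val (levi_par x)) * incl u.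
    by rewrite [LHS]rmorphM; congr (_ * _); exact: uea_map_in.
  by rewrite -!scalerA -E parabolic_tensor levi_par_proj.
Qed.

Lemma res_form_contravariant : is_contravariant tau_l res_form.
Proof.
split.
- by move=> w a u v; rewrite /res_form one_tensorD one_tensorZ rmorph_alg
    contra_formDl contra_formZl.
- by move=> u a v w; rewrite /res_form one_tensorD one_tensorZ rmorph_alg
    contra_formDr contra_formZr.
- by move=> v w; case: (contra_formP G) => _ _ C _; exact: C.
- by move=> u v w; rewrite /res_form !one_tensorZ tau_lP contra_form_tau.
Qed.

Definition res_contra : contraForm tau_l V :=
  ContraForm (introT (asboolP _) res_form_contravariant).
End Restriction.

Lemma res_contra_inj : injective res_contra.
Proof.
move=> G G' E; apply: contraForm_eq => x y; apply/eqP; rewrite -subr_eq0; apply/eqP.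
move: x y; apply: (@ind_form_eq0 (fun x y => G x y - G' x y)).
- by move=> x y z; rewrite !contra_formDl opprD addrACA.
- by move=> x y z; rewrite !contra_formDr opprD addrACA.
- by move=> u x y; rewrite !contra_form_tau.
- move=> v w; apply/eqP; rewrite subr_eq0; apply/eqP.
  exact: (congr1 (fun f : contraForm tau_l V => f v w) E).
Qed.

Lemma ext_contraK : cancel ext_contra res_contra.
Proof. by move=> f; apply: contraForm_eq => v w; exact: ext_form1. Qed.

Lemma res_contraK : cancel res_contra ext_contra.
Proof. by move=> G; apply: res_contra_inj; rewrite ext_contraK. Qed.

(** Checked after restriction, which is injective, inverts the extension and is linear pointwise. *)
Lemma ext_contra_linear : linear ext_contra.
Proof.
move=> a f g; apply: res_contra_inj; rewrite ext_contraK.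
apply: contraForm_eq => v w.
rewrite -{1}[f]ext_contraK -{1}[g]ext_contraK.
by [].
Qed.
HB.instance Definition _ := GRing.isLinear.Build F (contraForm tau_l V)
  (contraForm tau (Ind V)) _ ext_contra ext_contra_linear.

Lemma contraForm_iso :
  exists phi : {linear contraForm tau_l V -> contraForm tau (Ind V)}, bijective phi.
Proof. by exists ext_contra; exists res_contra; [exact: ext_contraK|exact: res_contraK]. Qed.

End InducedForms.

(** Here [eta_lie] says that [eta] is a morphism to an abelian Lie algebra, and [tau_lP] that
    [tau_l] is the restriction of [tau] to the Levi. In [V_whittaker], [x] and [x'] are one vector
    of [n_eta], seen in the nilradical of the Borel subalgebra and in the Levi. *)
Theorem theorem1p2 (R : realType) (g : lieAlgType R[i]) (g_ss : semisimple g)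
    (D : rootSetup g) (B : chevalleyBasis D)
    (tau : Uea g -> Uea g) (tauP : transpose B tau)
    (eta : 'Hom(subLie_of (borel_nil D), R[i]^o))
    (eta_lie : forall x y, eta (lie x y) = 0)
    (tau_l : Uea (subLie_of (levi eta)) -> Uea (subLie_of (levi eta)))
    (tau_lP : forall u,
      uea_map (sub_incl (levi eta)) (tau_l u) = tau (uea_map (sub_incl (levi eta)) u))
    (V : lmodType (Uea (subLie_of (levi eta))))
    (V_simple : simple_module V) (V_fg : fin_gen_module V)
    (V_whittaker : forall v : V, exists2 k : nat, (0 < k)%N &
      forall (x : subLie_of (borel_nil D)) (x' : subLie_of (levi eta)),
        sub_val x \in n_eta eta -> sub_val x' = sub_val x ->
        (uea_in x' - (eta x)%:A) ^+ k *: v = 0) :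
  exists phi : {linear contraForm tau_l V -> contraForm tau (Ind V)}, bijective phi.
Proof. exact: (contraForm_iso tauP tau_lP V). Qed.
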